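(* Let $G$ be a finite group, $U$ a projective unitary representation of $G$ on a finite-dimensional Hilbert space $\mathcal{H}$, $H$ a Hamiltonian on $\mathcal{H}$ with $[U(g),H]=0$ for all $g\in G$, and $\rho$ a state on $\mathcal{H}$. Fix an inverse temperature $\beta>0$. Let $$K:=\Big\{g\in G\ \Big|\ U(g)\rho U(g)^\dagger\in\overline{\{e^{-itH}\rho e^{itH}\mid t\in\mathbb{R}\}}\Big\},$$ which is a subgroup of $G$. Then there exist $m\in\mathbb{N}$, a constant $\alpha>0$, and a sequence of sub-POVMs $(\{\widetilde{R}^{(k)}_x\}_{x\in G/K})_{k\in\mathbb{N}}$ on $\mathcal{H}^{\otimes mk^2}$ that are control-admissible in the resource theory of thermal operations, such that for all sufficiently large $k\in\mathbb{N}$ and all $g\in G$, $$\mathrm{tr}\Big(\mathcal{U}_g(\rho)^{\otimes mk^2}\,\widetilde{R}^{(k)}_{gK}\Big)\ge1-e^{-\alpha k}.$$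
   Context: $\mathcal{U}_g(\cdot)=U(g)\cdot U(g)^\dagger$; the bar denotes topological closure. On $n$ copies the Hamiltonian is the sum of single-copy Hamiltonians, and on a composite system the total Hamiltonian is the sum. A thermal operation from a system with Hamiltonian $H_1$ to a system with Hamiltonian $H_2$ is a channel $\mathcal{E}(L)=\mathrm{tr}_E(V(L\otimes\gamma_{\mathsf{B}})V^\dagger)$, where $\mathsf{B}$ is a finite-dimensional bath with arbitrary Hamiltonian $H_{\mathsf{B}}$, $\gamma_{\mathsf{B}}=e^{-\beta H_{\mathsf{B}}}/\mathrm{tr}(e^{-\beta H_{\mathsf{B}}})$, and $V$ is a unitary from input$\otimes\mathsf{B}$ to output$\otimes E$ intertwining $H_1+H_{\mathsf{B}}$ and $H_2+H_E$. A sub-POVM is a finite family of positive semidefinite operators $\{M_x\}_{x\in X_0}$ with $\sum_xM_x\le I$; put $M_\perp:=I-\sum_xM_x$. A sub-POVM on a system $Q$ is control-admissible in the resource theory of thermal operations if for all systems $B,C$ and all thermal operations $\mathcal{E}_x:B\to C$, $x\in X_0\cup\{\perp\}$, the map $L\mapsto\sum_{x\in X_0\cup\{\perp\}}\mathcal{E}_x(\mathrm{tr}_Q((M_x\otimes I_B)L))$ is a thermal operation from $QB$ to $C$. *)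

(* Defs.v *)
From HB Require Import structures.
From mathcomp Require Import all_boot all_order all_fingroup all_algebra.
From mathcomp Require Import complex mxtens.
From mathcomp Require Import boolp classical_sets filter reals topology.
From mathcomp Require Import normedtype sequences exp.

Set Implicit Arguments.
Unset Strict Implicit.
Unset Printing Implicit Defensive.

Import Order.TTheory GRing.Theory Num.Theory numFieldNormedType.Exports.

Local Open Scope ring_scope.
Local Open Scope complex_scope.
Local Open Scope sesquilinear_scope.

(* R[i] seen as a numClosedFieldType, because that is the structure on which the
   library defines the topology of the scalars and hence of complex matrices. *)
Notation Cplx R := (complex R : numClosedFieldType).

(* A finite-dimensional Hilbert space is C^n with its standard inner product,
   operators are n x n matrices, and the tensor product of C^m and C^n is
   C^(m * n) with the Kronecker product [*t] of mxtens. *)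

Definition expmx (R : realType) (n : nat) (A : 'M[Cplx R]_n) : 'M[Cplx R]_n :=
  limn (series (fun k => k`!%:R^-1 *: A ^+ k)).

Definition psdmx (R : realType) (n : nat) (A : 'M[Cplx R]_n) : Prop :=
  A \is hermsymmx /\ forall v : 'cV[Cplx R]_n, 0 <= (v ^t* *m A *m v) 0 0.

Definition state (R : realType) (n : nat) (rho : 'M[Cplx R]_n) : Prop :=
  psdmx rho /\ \tr rho = 1.

(* [unitarymx] only says V V^* = 1, so a unitary between spaces whose
   dimensions are not syntactically equal needs both conditions. *)
Definition unitary_map (R : realType) (m n : nat) (V : 'M[Cplx R]_(m, n)) : Prop :=
  V \is unitarymx /\ V ^t* \is unitarymx.

Definition proj_unitary_rep (R : realType) (gT : finGroupType) (n : nat)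
    (U : gT -> 'M[Cplx R]_n) : Prop :=
  (forall g, U g \is unitarymx) /\
  (forall g h, exists2 c : Cplx R, `|c| = 1 & U g *m U h = c *: U (g * h)%g).

(* Hamiltonian of a nonzero finite-dimensional system. *)
Definition hamiltonian (R : realType) (n : nat) (H : 'M[Cplx R]_n) : Prop :=
  (0 < n)%N /\ H \is hermsymmx.

Definition ham_sum (R : realType) (m n : nat)
    (H1 : 'M[Cplx R]_m) (H2 : 'M[Cplx R]_n) : 'M[Cplx R]_(m * n) :=
  H1 *t 1%:M + 1%:M *t H2.

(* The recursion follows that of [ntensmx] (notation [A ^t n]), so that both
   live in dimension d ^ n; zero copies form the space C with Hamiltonian 0. *)
Fixpoint ham_copies_rec (R : realType) (d : nat) (H : 'M[Cplx R]_d) (n : nat) :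
    'M[Cplx R]_(d ^ n.+1) :=
  if n is n'.+1 then ham_sum H (ham_copies_rec H n') else H.

Definition ham_copies (R : realType) (d : nat) (H : 'M[Cplx R]_d) (n : nat) :
    'M[Cplx R]_(d ^ n) :=
  if n is n'.+1 return 'M[Cplx R]_(d ^ n) then ham_copies_rec H n' else 0.

(* Partial traces over the first and over the second tensor factor. *)
Definition ptrace1 (R : realType) (m n : nat) (A : 'M[Cplx R]_(m * n)) :
    'M[Cplx R]_n :=
  \matrix_(i, j) \sum_(k < m) A (mxtens_index (k, i)) (mxtens_index (k, j)).

Definition ptrace2 (R : realType) (m n : nat) (A : 'M[Cplx R]_(m * n)) :
    'M[Cplx R]_m :=
  \matrix_(i, j) \sum_(k < n) A (mxtens_index (i, k)) (mxtens_index (j, k)).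

Definition gibbs (R : realType) (beta : R) (n : nat) (H : 'M[Cplx R]_n) :
    'M[Cplx R]_n :=
  (\tr (expmx (- beta%:C *: H)))^-1 *: expmx (- beta%:C *: H).

Definition thermal_op (R : realType) (beta : R) (n1 n2 : nat)
    (H1 : 'M[Cplx R]_n1) (H2 : 'M[Cplx R]_n2)
    (F : 'M[Cplx R]_n1 -> 'M[Cplx R]_n2) : Prop :=
  exists (b e : nat) (HB : 'M[Cplx R]_b) (HE : 'M[Cplx R]_e)
         (V : 'M[Cplx R]_(n2 * e, n1 * b)),
    [/\ hamiltonian HB,
        hamiltonian HE,
        unitary_map V,
        V *m ham_sum H1 HB = ham_sum H2 HE *m V
      & forall L, F L = ptrace2 (V *m (L *t gibbs beta HB) *m V ^t*)].

(* A finite family of operators is given by a function on a finite type I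
   together with its index set X0; only the values on X0 matter. *)
Definition sub_povm (R : realType) (n : nat) (I : finType) (X0 : {set I})
    (M : I -> 'M[Cplx R]_n) : Prop :=
  (forall x, x \in X0 -> psdmx (M x)) /\ psdmx (1%:M - \sum_(x in X0) M x).

(* The indices in X0 are handled by M and F, the extra index bottom by
   1 - \sum_x M x and Fbot. *)
Definition control_admissible (R : realType) (beta : R) (q : nat)
    (HQ : 'M[Cplx R]_q) (I : finType) (X0 : {set I})
    (M : I -> 'M[Cplx R]_q) : Prop :=
  forall (b c : nat) (HB : 'M[Cplx R]_b) (HC : 'M[Cplx R]_c)
         (F : I -> 'M[Cplx R]_b -> 'M[Cplx R]_c) (Fbot : 'M[Cplx R]_b -> 'M[Cplx R]_c),
    hamiltonian HB -> hamiltonian HC ->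
    (forall x, x \in X0 -> thermal_op beta HB HC (F x)) ->
    thermal_op beta HB HC Fbot ->
    thermal_op beta (ham_sum HQ HB) HC (fun L : 'M[Cplx R]_(q * b) =>
      \sum_(x in X0) F x (ptrace1 ((M x *t 1%:M) *m L))
      + Fbot (ptrace1 (((1%:M - \sum_(x in X0) M x) *t 1%:M) *m L))).

Definition time_orbit (R : realType) (n : nat) (H rho : 'M[Cplx R]_n) :
    set 'M[Cplx R]_n :=
  [set expmx (- ('i * t%:C) *: H) *m rho *m expmx (('i * t%:C) *: H)
    | t in [set: R]]%classic.

(* The elements g such that U_g(rho) lies in the closure of the time orbit of
   rho; [asbool] makes this undecidable condition a finite set. *)
Definition time_orbit_stab (R : realType) (gT : finGroupType) (n : nat)
    (U : gT -> 'M[Cplx R]_n) (H rho : 'M[Cplx R]_n) : {set gT} :=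
  finset (fun g => `[< closure (time_orbit H rho) (U g *m rho *m (U g) ^t*) >]).

(* Main.v *)
Require Import Defs.
From HB Require Import structures.
From mathcomp Require Import all_boot all_order all_fingroup all_algebra.
From mathcomp Require Import complex mxtens.
From mathcomp Require Import boolp classical_sets filter reals topology.
From mathcomp Require Import normedtype sequences exp trigo.
From mathcomp Require Import ring lra.

Set Implicit Arguments.
Unset Strict Implicit.
Unset Printing Implicit Defensive.

Import Order.TTheory GRing.Theory Num.Theory numFieldNormedType.Exports.

Local Open Scope ring_scope.
Local Open Scope complex_scope.
Local Open Scope sesquilinear_scope.

(* Orthogonal projectors P_x commuting with the Hamiltonian of Q are control-admissible:
   after merging the baths of the operations E_x into one, sum_x P_x (x) V_x is an
   energy-preserving unitary whose output environment is Q (x) E.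

   Let sigma_g = U_g(rho), let c = tr(rho^2), and let A_g be the pinching of the p-th
   tensor power of sigma_g by the Hamiltonian of p copies.  The spectrum of that
   Hamiltonian has at most (p+1)^d points, so the pinching inequality gives
   tr(A_g sigma_g^p) >= c^p / (p+1)^d.  On the other hand tr(A_g sigma_h^p) is the
   constant term of a trigonometric polynomial in t, hence at most
   sup_t tr(sigma_g sigma_h(t))^p <= (c r)^p with r < 1 when gK <> hK.  For p large the
   A_g, and then a generic real combination A of them, separate the cosets; the
   expectation of A depends only on the coset, because A is invariant in time.

   Take m = p and measure the mean of A over k^2 blocks of p copies: the projectors on
   disjoint windows around the finitely many expectations form the sub-POVM, and
   Chernoff's bound makes the error at most 2 exp(- eta k^2) <= exp(- eta k). *)

(** * Tensor products, adjoints and functional calculus *)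

(** The obstacle is that the admissibility criterion used here asks for projectors commuting with
    the Hamiltonian, whereas the states of different cosets may differ only in coherences between
    energy levels. Coherences of several copies combine into energy-conserving ones, so pinching
    many copies keeps the distinction: it costs the polynomial factor (p+1)^d, while distinct cosets
    differ by the exponential factor r^p. That r < 1 comes from the closure in the definition of K:
    outside K the distance to the orbit is bounded below, and since all states involved have the
    same purity, distance and overlap determine each other. A single A_g need not tell two other
    cosets apart; a real combination turns the whole family of tests into one number to be
    estimated. Taking k^2 blocks leaves room to absorb the factor 2 of the two-sided tail bound.
    Merging the baths equalises the dimensions of the environments but not their Hamiltonians;
    keeping Q in the environment allows its Hamiltonian to depend on x. *)

Section Reindexing.
Variable K : pzSemiRingType.

Lemma mxsubM m n p m' n' p' (f : 'I_m' -> 'I_m) (h : 'I_n' -> 'I_n)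
    (g : 'I_p' -> 'I_p) (A : 'M[K]_(m, n)) (B : 'M[K]_(n, p)) :
  bijective h -> mxsub f g (A *m B) = mxsub f h A *m mxsub h g B.
Proof.
move=> bij_h; apply/matrixP=> i j; rewrite !mxE (reindex h) /=; last exact: onW_bij.
by apply: eq_bigr => k _; rewrite !mxE.
Qed.

Lemma mxsub1 m m' (f : 'I_m' -> 'I_m) : injective f -> mxsub f f 1%:M = 1%:M :> 'M[K]_m'.
Proof. by move=> inj_f; apply/matrixP=> i j; rewrite !mxE (inj_eq inj_f). Qed.

Lemma mxtrace_mxsub m m' (f : 'I_m' -> 'I_m) (A : 'M[K]_m) :
  bijective f -> \tr (mxsub f f A) = \tr A.
Proof.
move=> bij_f; rewrite /mxtrace [RHS](reindex f) /=; last exact: onW_bij.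
by apply: eq_bigr => i _; rewrite mxE.
Qed.

End Reindexing.

Section Tensor.
Variable K : comPzRingType.

Lemma tensmxDl m n p q (A B : 'M[K]_(m, n)) (D : 'M[K]_(p, q)) :
  (A + B) *t D = A *t D + B *t D.
Proof. by apply/matrixP=> i j; rewrite !mxE mulrDl. Qed.

Lemma tensmxDr m n p q (A B : 'M[K]_(m, n)) (D : 'M[K]_(p, q)) :
  D *t (A + B) = D *t A + D *t B.
Proof. by apply/matrixP=> i j; rewrite !mxE mulrDr. Qed.

Lemma tensmxZl m n p q c (A : 'M[K]_(m, n)) (D : 'M[K]_(p, q)) :
  (c *: A) *t D = c *: (A *t D).
Proof. by apply/matrixP=> i j; rewrite !mxE mulrA. Qed.

Lemma tensmxZr m n p q c (A : 'M[K]_(m, n)) (D : 'M[K]_(p, q)) :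
  D *t (c *: A) = c *: (D *t A).
Proof. by apply/matrixP=> i j; rewrite !mxE mulrCA. Qed.

Lemma tensmx_suml (I : finType) (P : pred I) m n p q
    (A : I -> 'M[K]_(m, n)) (D : 'M[K]_(p, q)) :
  (\sum_(x | P x) A x) *t D = \sum_(x | P x) A x *t D.
Proof.
apply/matrixP=> i j; rewrite !(mxE, summxE) mulr_suml.
by apply: eq_bigr => x _; rewrite mxE.
Qed.

Lemma tensmx_sumr (I : finType) (P : pred I) m n p q
    (A : I -> 'M[K]_(m, n)) (D : 'M[K]_(p, q)) :
  D *t (\sum_(x | P x) A x) = \sum_(x | P x) D *t A x.
Proof.
apply/matrixP=> i j; rewrite !(mxE, summxE) mulr_sumr.
by apply: eq_bigr => x _; rewrite mxE.
Qed.

Lemma mxtens_index_inj m n : injective (@mxtens_index m n).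
Proof. exact: can_inj (@mxtens_indexK m n). Qed.

Lemma tensmx11 m n : 1%:M *t 1%:M = 1%:M :> 'M[K]_(m * n).
Proof.
apply/matrixP=> i j; case: (mxtens_indexP i) => i1 i2; case: (mxtens_indexP j) => j1 j2.
rewrite tensmxE !mxE (inj_eq (@mxtens_index_inj _ _)) xpair_eqE.
by case: eqP; case: eqP; rewrite /= ?mulr0 ?mulr1 ?mul0r.
Qed.

Lemma sum_mxtens m n (V : nmodType) (F : 'I_(m * n) -> V) :
  \sum_k F k = \sum_i \sum_j F (mxtens_index (i, j)).
Proof.
rewrite pair_big (reindex (@mxtens_index m n)) /=.
  by apply: eq_bigr => -[].
by apply: onW_bij; exists (@mxtens_unindex m n); [exact: mxtens_indexK | exact: mxtens_unindexK].
Qed.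

Lemma mxtrace_tens m n (A : 'M[K]_m) (B : 'M[K]_n) : \tr (A *t B) = \tr A * \tr B.
Proof.
rewrite /mxtrace sum_mxtens mulr_suml; apply: eq_bigr => i _.
by rewrite mulr_sumr; apply: eq_bigr => j _; rewrite tensmxE.
Qed.

Lemma delta_mx_tens m n p q (i1 : 'I_m) (j1 : 'I_n) (i2 : 'I_p) (j2 : 'I_q) :
  delta_mx i1 j1 *t delta_mx i2 j2
    = delta_mx (mxtens_index (i1, i2)) (mxtens_index (j1, j2)) :> 'M[K]_(_, _).
Proof.
apply/matrixP=> i j; case: (mxtens_indexP i) => k1 k2; case: (mxtens_indexP j) => l1 l2.
rewrite tensmxE !mxE !(inj_eq (@mxtens_index_inj _ _)) !xpair_eqE.
by do 4!case: eqP; rewrite /= ?mulr0 ?mulr1 ?mul0r.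
Qed.

End Tensor.

Section Adjoint.
Variable C : numClosedFieldType.

Lemma adjmxM m n p (A : 'M[C]_(m, n)) (B : 'M[C]_(n, p)) :
  (A *m B) ^t* = B ^t* *m A ^t*.
Proof. by rewrite trmx_mul map_mxM. Qed.

Lemma adjmx_tens m n p q (A : 'M[C]_(m, n)) (B : 'M[C]_(p, q)) :
  (A *t B) ^t* = A ^t* *t B ^t*.
Proof. by rewrite trmx_tens map_mxT. Qed.

Lemma adjmx_sub m n m' n' (f : 'I_m' -> 'I_m) (g : 'I_n' -> 'I_n) (A : 'M[C]_(m, n)) :
  (mxsub f g A) ^t* = mxsub g f (A ^t*).
Proof. by apply/matrixP=> i j; rewrite !mxE. Qed.

Lemma adjmxD m n (A B : 'M[C]_(m, n)) : (A + B) ^t* = A ^t* + B ^t*.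
Proof. by rewrite linearD map_mxD. Qed.

Lemma adjmxZ m n c (A : 'M[C]_(m, n)) : (c *: A) ^t* = c^*%R *: A ^t*.
Proof. by rewrite linearZ map_mxZ. Qed.

Lemma adjmx_sum (I : finType) (P : pred I) m n (A : I -> 'M[C]_(m, n)) :
  (\sum_(x | P x) A x) ^t* = \sum_(x | P x) (A x) ^t*.
Proof.
apply/matrixP=> i j; rewrite !(mxE, summxE) rmorph_sum.
by apply: eq_bigr => x _; rewrite !mxE.
Qed.

Lemma adjmx1 n : (1%:M : 'M[C]_n) ^t* = 1%:M.
Proof. by rewrite trmx1 map_mx1. Qed.

Lemma adjmxE m n (A : 'M[C]_(m, n)) i j : A ^t* i j = (A j i)^*%R.
Proof. by rewrite !mxE. Qed.

Lemma hermsymmxP n (A : 'M[C]_n) : A \is hermsymmx <-> A ^t* = A.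
Proof.
split=> [/is_hermitianmxP|A_adj]; first by rewrite expr0 scale1r => <-.
by apply/is_hermitianmxP; rewrite expr0 scale1r A_adj.
Qed.

Lemma mxtrace_adj n (A : 'M[C]_n) : \tr (A ^t*) = (\tr A)^*%R.
Proof. by rewrite /mxtrace rmorph_sum; apply: eq_bigr => i _; rewrite !mxE. Qed.

End Adjoint.

Section UnitaryMap.
Variable R : realType.
Implicit Types m n p q : nat.

Lemma unitary_mapP m n (V : 'M[Cplx R]_(m, n)) :
  unitary_map V <-> V *m V ^t* = 1%:M /\ V ^t* *m V = 1%:M.
Proof.
split=> [[/unitarymxP VV /unitarymxP]|[VV V'V]]; first by rewrite trmxCK.
by split; apply/unitarymxP; rewrite ?trmxCK.
Qed.

Lemma unitary_map_square n (V : 'M[Cplx R]_n) : V \is unitarymx -> unitary_map V.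
Proof. by move=> V_unit; split; rewrite ?trmxC_unitary. Qed.

Lemma unitary_map_dim m n (V : 'M[Cplx R]_(m, n)) : unitary_map V -> m = n.
Proof.
case=> /mxrank_unitary rkV /mxrank_unitary rkV'; apply/eqP.
by rewrite eqn_leq -{1}rkV rank_leq_col -{1}rkV' rank_leq_col.
Qed.

Lemma unitary_map_sub m n m' n' (f : 'I_m' -> 'I_m) (g : 'I_n' -> 'I_n)
    (V : 'M[Cplx R]_(m, n)) :
  bijective f -> bijective g -> unitary_map V -> unitary_map (mxsub f g V).
Proof.
move=> bij_f bij_g /unitary_mapP[VV V'V]; apply/unitary_mapP.
rewrite adjmx_sub -!mxsubM // VV V'V !mxsub1 //; exact: bij_inj.
Qed.

Lemma unitary_map_tens m n p q (V : 'M[Cplx R]_(m, n)) (W : 'M[Cplx R]_(p, q)) :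
  unitary_map V -> unitary_map W -> unitary_map (V *t W).
Proof.
move=> /unitary_mapP[VV V'V] /unitary_mapP[WW W'W]; apply/unitary_mapP.
by rewrite adjmx_tens !tensmx_mul VV V'V WW W'W !tensmx11.
Qed.

Lemma unitary_map1 n : unitary_map (1%:M : 'M[Cplx R]_n).
Proof. by apply/unitary_mapP; rewrite adjmx1 mulmx1. Qed.

End UnitaryMap.

(* The matrix W^* diag(c) W. Like several definitions below it is locked, because
   failed unifications would otherwise unfold it. *)
HB.lock Definition fcalc {R : realType} {n m : nat} (W : 'M[Cplx R]_(n, m))
    (c : 'I_n -> Cplx R) : 'M[Cplx R]_m :=
  W ^t* *m diag_mx (\row_i c i) *m W.

Section FunctionalCalculus.
Variable R : realType.
Implicit Types m n p q : nat.

Lemma fcalc_unlock n m (W : 'M[Cplx R]_(n, m)) c :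
  fcalc W c = W ^t* *m diag_mx (\row_i c i) *m W.
Proof. by rewrite fcalc.unlock. Qed.

Lemma eq_fcalc n m (W : 'M[Cplx R]_(n, m)) c c' : c =1 c' -> fcalc W c = fcalc W c'.
Proof. by move=> /boolp.funext ->. Qed.

Lemma fcalcE n m (W : 'M[Cplx R]_(n, m)) c i j :
  fcalc W c i j = \sum_k c k * ((W k i)^*%R * W k j).
Proof.
rewrite !fcalc_unlock mul_mx_diag mxE; apply: eq_bigr => k _.
by rewrite !mxE mulrAC mulrC.
Qed.

Lemma fcalcM n m (W : 'M[Cplx R]_(n, m)) c c' : unitary_map W ->
  fcalc W c *m fcalc W c' = fcalc W (fun i => c i * c' i).
Proof.
case/unitary_mapP=> WW _; rewrite !fcalc_unlock !mulmxA -(mulmxA _ W) WW mulmx1.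
rewrite -(mulmxA (W ^t*)) mulmx_diag; congr (_ *m diag_mx _ *m _).
by apply/rowP=> i; rewrite !mxE.
Qed.

Lemma fcalc1 n m (W : 'M[Cplx R]_(n, m)) : unitary_map W -> fcalc W (fun=> 1) = 1%:M.
Proof.
case/unitary_mapP=> _ W'W; rewrite !fcalc_unlock -[RHS]W'W; congr (_ *m _).
rewrite -[RHS]mulmx1; congr (_ *m _); apply/matrixP=> i j.
by rewrite !mxE.
Qed.

Lemma fcalc_sum (I : Type) (r : seq I) (P : pred I) n m (W : 'M[Cplx R]_(n, m))
    (c : I -> 'I_n -> Cplx R) :
  \sum_(x <- r | P x) fcalc W (c x) = fcalc W (fun i => \sum_(x <- r | P x) c x i).
Proof.
apply/matrixP=> i j; rewrite summxE fcalcE.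
under eq_bigr do rewrite fcalcE.
by rewrite exchange_big; apply: eq_bigr => k _; rewrite mulr_suml.
Qed.

Lemma fcalcZ n m (W : 'M[Cplx R]_(n, m)) a c :
  a *: fcalc W c = fcalc W (fun i => a * c i).
Proof.
apply/matrixP=> i j; rewrite mxE !fcalcE mulr_sumr.
by apply: eq_bigr => k _; rewrite mulrA.
Qed.

Lemma fcalcD n m (W : 'M[Cplx R]_(n, m)) c c' :
  fcalc W c + fcalc W c' = fcalc W (fun i => c i + c' i).
Proof.
apply/matrixP=> i j; rewrite mxE !fcalcE -big_split.
by apply: eq_bigr => k _; rewrite mulrDl.
Qed.

Lemma fcalc_adj n m (W : 'M[Cplx R]_(n, m)) c :
  (fcalc W c) ^t* = fcalc W (fun i => (c i)^*%R).
Proof.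
apply/matrixP=> i j; rewrite adjmxE !fcalcE rmorph_sum; apply: eq_bigr => k _.
by rewrite !rmorphM /= conjCK; congr (_ * _); rewrite mulrC.
Qed.

Lemma mxtrace_fcalc n m (W : 'M[Cplx R]_(n, m)) c (X : 'M[Cplx R]_m) :
  \tr (fcalc W c *m X) = \sum_i c i * (W *m X *m W ^t*) i i.
Proof.
rewrite !fcalc_unlock -!mulmxA mxtrace_mulC -!mulmxA; apply: eq_bigr => i _.
by rewrite mul_diag_mx mxE; congr (_ * _); rewrite !mxE.
Qed.

Lemma fcalc_tens n m p q (W : 'M[Cplx R]_(n, m)) (W' : 'M[Cplx R]_(p, q)) c c' :
  fcalc W c *t fcalc W' c'
    = fcalc (W *t W') (fun k => c (mxtens_unindex k).1 * c' (mxtens_unindex k).2).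
Proof.
rewrite !fcalc_unlock adjmx_tens -!tensmx_mul; congr (_ *m _ *m _); apply/matrixP=> i j.
case: (mxtens_indexP i) => i1 i2; case: (mxtens_indexP j) => j1 j2.
rewrite tensmxE !mxE !(inj_eq (@mxtens_index_inj _ _)) !xpair_eqE mxtens_indexK /=.
by do 2!case: eqP; rewrite /= ?mulr0 ?mul0r.
Qed.

Lemma fcalc_sub n m p (W : 'M[Cplx R]_(n, m)) c (f : 'I_p -> 'I_m) :
  mxsub f f (fcalc W c) = fcalc (colsub f W) c.
Proof.
by apply/matrixP=> i j; rewrite mxE !fcalcE; apply: eq_bigr => k _; rewrite !mxE.
Qed.

Lemma conj_fcalc n m (W : 'M[Cplx R]_(n, m)) c : unitary_map W ->
  W *m fcalc W c *m W ^t* = diag_mx (\row_i c i).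
Proof.
case/unitary_mapP=> WW _; rewrite !fcalc_unlock !mulmxA WW mul1mx -mulmxA WW.
by rewrite mulmx1.
Qed.

(** In the eigenbasis given by [W], commuting with [fcalc W a] says that the entry (i, j) of [G]
    vanishes unless [a i = a j], and then [b i = b j] as well. *)
Lemma fcalc_comm n m (W : 'M[Cplx R]_(n, m)) (a b : 'I_n -> Cplx R) (G : 'M[Cplx R]_m) :
  unitary_map W -> (forall i j, a i = a j -> b i = b j) ->
  fcalc W a *m G = G *m fcalc W a -> fcalc W b *m G = G *m fcalc W b.
Proof.
move=> W_unit ab commG; have [WW W'W] := (unitary_mapP W).1 W_unit.
set G' := W *m G *m W ^t*.
have GE : G = W ^t* *m G' *m W.
  by rewrite /G' !mulmxA W'W mul1mx -mulmxA W'W mulmx1.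
clearbody G'.
have fcalcG c : fcalc W c *m G = W ^t* *m (diag_mx (\row_i c i) *m G') *m W.
  by rewrite GE fcalc_unlock !mulmxA -(mulmxA _ W) WW mulmx1.
have Gfcalc c : G *m fcalc W c = W ^t* *m (G' *m diag_mx (\row_i c i)) *m W.
  by rewrite {1}GE fcalc_unlock !mulmxA -(mulmxA _ W) WW mulmx1.
rewrite fcalcG Gfcalc; congr (_ *m _ *m _); apply/matrixP=> i j.
have : W *m (fcalc W a *m G) *m W ^t* = W *m (G *m fcalc W a) *m W ^t* by rewrite commG.
rewrite fcalcG Gfcalc !mulmxA WW !mul1mx -!(mulmxA _ W) WW !mulmx1.
move=> /matrixP/(_ i j); rewrite !mul_mx_diag !mul_diag_mx !mxE => /eqP.
rewrite mulrC -subr_eq0 -mulrBr mulf_eq0 => /orP[/eqP->|]; first by rewrite mulr0 mul0r.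
by rewrite subr_eq0 => /eqP/ab ->; rewrite mulrC.
Qed.

Lemma hermitian_fcalc n (A : 'M[Cplx R]_n) : A \is hermsymmx ->
  exists (W : 'M[Cplx R]_n) (a : 'I_n -> R),
    unitary_map W /\ A = fcalc W (fun i => (a i)%:C).
Proof.
move=> A_herm; have A_real := hermitian_spectral_diag_real A_herm.
exists (spectralmx A), (fun i => complex.Re (spectral_diag A 0 i)); split.
  exact/unitary_map_square/spectral_unitarymx.
rewrite !fcalc_unlock -invmx_unitary ?spectral_unitarymx //.
rewrite {1}(orthomx_spectralP (hermitian_normalmx A_herm)).
congr (_ *m diag_mx _ *m _); apply/rowP=> i; rewrite mxE RRe_real //.
exact: (mxOverP A_real).
Qed.

End FunctionalCalculus.

(** * Exponentials of diagonalised matrices *)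

HB.lock Definition cis {R : realType} (x : R) : Cplx R := cos x +i* sin x.

Section Exponential.
Variable R : realType.

Lemma cvgn_sum (K : numFieldType) (V : normedModType K) (I : Type) (r : seq I)
    (f : I -> nat -> V) (l : I -> V) :
  (forall i, f i n @[n --> \oo] --> l i)%classic ->
  ((\sum_(i <- r) f i n) @[n --> \oo] --> \sum_(i <- r) l i)%classic.
Proof.
move=> f_l; elim: r => [|i r IHr].
  by rewrite big_nil; under boolp.eq_fun do rewrite big_nil; exact: cvg_cst.
by rewrite big_cons; under boolp.eq_fun do rewrite big_cons; exact: cvgD.
Qed.

Lemma cvgn_real_complex (u : nat -> R) (l : R) :
  (u n @[n --> \oo] --> l)%classic ->
  (((u n)%:C : Cplx R) @[n --> \oo] --> (l%:C : Cplx R))%classic.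
Proof.
move=> u_l; apply/cvgrPdist_lt => eps eps_gt0.
have /complex_realP[e epsE] : eps \is Num.real by apply: gtr0_real.
rewrite epsE ltcR in eps_gt0 *.
have /cvgrPdist_lt/(_ _ eps_gt0)[N _ uN] := u_l; exists N => // n /uN /=.
by rewrite -rmorphB /= normc_def /= expr0n addr0 sqrtr_sqr ltcR.
Qed.

Lemma cis_unlock (x : R) : cis x = cos x +i* sin x.
Proof. by rewrite cis.unlock. Qed.

Lemma cisE (x : R) : cis x = (cos x)%:C + 'i%R * (sin x)%:C.
Proof. by rewrite -complexiE cis_unlock; simpc. Qed.

Lemma cis0 : cis (0 : R) = 1.
Proof. by rewrite cis_unlock cos0 sin0. Qed.

Lemma cisD (x y : R) : cis (x + y) = cis x * cis y.
Proof. by rewrite !cis_unlock cosD sinD; simpc; rewrite [sin x * _ + _]addrC. Qed.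

Lemma cis_conj (x : R) : (cis x)^*%R = cis (- x).
Proof. by rewrite !cis_unlock cosN sinN. Qed.

Lemma cispi : cis (pi : R) = -1.
Proof. by rewrite cis_unlock cospi sinpi; apply/eqP; rewrite eq_complex /= oppr0 !eqxx. Qed.

Lemma exp_term_imaginary (x : R) k :
  k`!%:R^-1 * ('i%R * x%:C) ^+ k = (cos_coeff x k)%:C + 'i%R * (sin_coeff x k)%:C :> Cplx R.
Proof.
have iX : ('i%R : Cplx R) ^+ k = (-1) ^+ k./2 * (if odd k then 'i%R else 1).
  rewrite -{1}(odd_double_half k) -mul2n exprD exprM sqrCi mulrC.
  by case: (odd k).
rewrite exprMn iX /cos_coeff /sin_coeff /= !rmorphM /= !fmorphV !rmorphXn !rmorph_nat /=.
rewrite !rmorphN !rmorph1.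
case: ifPn => odd_k /=; rewrite ?mul0r ?mulr0 ?mul1r ?add0r ?addr0; last by ring.
have -> : (k.-1)./2 = k./2 by case: (k) odd_k => //= n; rewrite uphalf_half /= => /negbTE ->.
by ring.
Qed.

Lemma cvg_exp_imaginary (x : R) :
  (series (fun k => k`!%:R^-1 * ('i%R * x%:C) ^+ k : Cplx R) @ \oo --> cis x)%classic.
Proof.
rewrite cisE; have -> : series (fun k => k`!%:R^-1 * ('i%R * x%:C) ^+ k)
    = (fun n => (series (cos_coeff x) n)%:C + 'i%R * (series (sin_coeff x) n)%:C)
    :> (nat -> Cplx R).
  apply: boolp.funext => n; rewrite /series /=.
  under eq_bigr do rewrite exp_term_imaginary.
  by rewrite big_split -mulr_sumr !rmorph_sum.
apply: cvgD; first by apply: cvgn_real_complex; rewrite unlock; exact: is_cvg_series_cos_coeff.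
apply: cvgM; first exact: cvg_cst.
by apply: cvgn_real_complex; rewrite unlock; exact: is_cvg_series_sin_coeff.
Qed.

Lemma cvg_exp_real (x : R) :
  (series (fun k => k`!%:R^-1 * x%:C ^+ k : Cplx R) @ \oo --> ((expR x)%:C : Cplx R))%classic.
Proof.
have -> : series (fun k => k`!%:R^-1 * x%:C ^+ k)
    = (fun n => (series (exp_coeff x) n)%:C) :> (nat -> Cplx R).
  apply: boolp.funext => n; rewrite /series /= rmorph_sum; apply: eq_bigr => k _.
  by rewrite /exp_coeff /= rmorphM /= fmorphV rmorphXn rmorph_nat mulrC.
by apply: cvgn_real_complex; exact: is_cvg_series_exp_coeff.
Qed.

Lemma fcalcX n m (W : 'M[Cplx R]_(n, m)) c k : unitary_map W ->
  fcalc W c ^+ k = fcalc W (fun i => c i ^+ k).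
Proof.
move=> W_unit; elim: k => [|k IHk].
  by rewrite expr0 -[LHS](fcalc1 W_unit); apply: eq_fcalc => i; rewrite expr0.
by rewrite exprS IHk [LHS](fcalcM _ _ W_unit); apply: eq_fcalc => i; rewrite exprS.
Qed.

(** Only the scalar coefficients depend on [c], the matrices are fixed and finite in number; this
    reduces the convergence of the matrix exponential to that of scalar series. *)
Lemma fcalc_delta n m (W : 'M[Cplx R]_(n, m)) c :
  fcalc W c = \sum_i c i *: fcalc W (fun j => (j == i)%:R).
Proof.
under eq_bigr do rewrite fcalcZ.
rewrite fcalc_sum; apply: eq_fcalc => j.
rewrite (bigD1 j) //= eqxx mulr1 big1 ?addr0 // => i.
by rewrite eq_sym => /negbTE ->; rewrite mulr0.
Qed.

Lemma expmx_fcalc n m (W : 'M[Cplx R]_(n, m)) z c (e : 'I_n -> Cplx R) :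
  unitary_map W ->
  (forall i, (series (fun k => k`!%:R^-1 * (z * c i) ^+ k) @ \oo --> e i)%classic) ->
  expmx (z *: fcalc W c) = fcalc W e.
Proof.
move=> W_unit e_lim; rewrite /expmx fcalcZ.
have -> : series (fun k => k`!%:R^-1 *: fcalc W (fun i => z * c i) ^+ k)
   = (fun n => \sum_i (series (fun k => k`!%:R^-1 * (z * c i) ^+ k) n
                        *: fcalc W (fun j => (j == i)%:R))).
  apply: boolp.funext => N; rewrite -fcalc_delta /series /=.
  rewrite -fcalc_sum; apply: eq_bigr => k _.
  by rewrite fcalcX // fcalcZ.
apply: cvg_lim; first exact: norm_hausdorff.
rewrite (fcalc_delta W e); apply: cvgn_sum => i.
by apply: cvgZr_tmp; exact: e_lim.
Qed.

Lemma expmx_fcalc_real n m (W : 'M[Cplx R]_(n, m)) (b : R) (a : 'I_n -> R) :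
  unitary_map W ->
  expmx (b%:C *: fcalc W (fun i => (a i)%:C)) = fcalc W (fun i => (expR (b * a i))%:C).
Proof.
by move=> W_unit; apply: expmx_fcalc => // i; rewrite -rmorphM; exact: cvg_exp_real.
Qed.

Lemma expmx_fcalc_imaginary n m (W : 'M[Cplx R]_(n, m)) (t : R) (a : 'I_n -> R) :
  unitary_map W ->
  expmx (('i%R * t%:C) *: fcalc W (fun i => (a i)%:C)) = fcalc W (fun i => cis (t * a i)).
Proof.
move=> W_unit; apply: expmx_fcalc => // i.
by rewrite -mulrA -rmorphM; exact: cvg_exp_imaginary.
Qed.

End Exponential.

(** * Permutations of tensor factors, partial traces and Gibbs states *)

Section IndexBijections.

(** Reorderings of tensor factors are kept as bijections of indices and applied with [mxsub], which
    is compatible with products, adjoints and traces, so that no permutation matrices occur. *)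
Definition ord_tens m n m' n' (f : 'I_m' -> 'I_m) (g : 'I_n' -> 'I_n)
    (k : 'I_(m' * n')) : 'I_(m * n) :=
  mxtens_index (f (mxtens_unindex k).1, g (mxtens_unindex k).2).

Definition ord_assoc m n p (k : 'I_(m * (n * p))) : 'I_(m * n * p) :=
  mxtens_index (mxtens_index ((mxtens_unindex k).1, (mxtens_unindex (mxtens_unindex k).2).1),
    (mxtens_unindex (mxtens_unindex k).2).2).

Definition ord_assocV m n p (k : 'I_(m * n * p)) : 'I_(m * (n * p)) :=
  mxtens_index ((mxtens_unindex (mxtens_unindex k).1).1,
    mxtens_index ((mxtens_unindex (mxtens_unindex k).1).2, (mxtens_unindex k).2)).

Definition ord_swap m n (k : 'I_(m * n)) : 'I_(n * m) :=
  mxtens_index ((mxtens_unindex k).2, (mxtens_unindex k).1).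

Lemma ord_tensE m n m' n' (f : 'I_m' -> 'I_m) (g : 'I_n' -> 'I_n) i j :
  ord_tens f g (mxtens_index (i, j)) = mxtens_index (f i, g j).
Proof. by rewrite /ord_tens mxtens_indexK. Qed.

Lemma ord_assocE m n p (i : 'I_m) (j : 'I_n) (k : 'I_p) :
  ord_assoc (mxtens_index (i, mxtens_index (j, k))) = mxtens_index (mxtens_index (i, j), k).
Proof.
by rewrite /ord_assoc mxtens_indexK -[X in mxtens_unindex X]/(mxtens_index (j, k)) mxtens_indexK.
Qed.

Lemma ord_assocVE m n p (i : 'I_m) (j : 'I_n) (k : 'I_p) :
  ord_assocV (mxtens_index (mxtens_index (i, j), k)) = mxtens_index (i, mxtens_index (j, k)).
Proof.
by rewrite /ord_assocV mxtens_indexK -[X in mxtens_unindex X]/(mxtens_index (i, j)) mxtens_indexK.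
Qed.

Lemma ord_swapE m n (i : 'I_m) (j : 'I_n) :
  ord_swap (mxtens_index (i, j)) = mxtens_index (j, i).
Proof. by rewrite /ord_swap mxtens_indexK. Qed.

Lemma ord_tens_bij m n m' n' (f : 'I_m' -> 'I_m) (g : 'I_n' -> 'I_n) :
  bijective f -> bijective g -> bijective (ord_tens f g).
Proof.
move=> [f' fK f'K] [g' gK g'K]; exists (ord_tens f' g') => k;
  by case: (mxtens_indexP k) => i j; rewrite !ord_tensE ?fK ?gK ?f'K ?g'K.
Qed.

Lemma ord_assocK m n p : cancel (@ord_assoc m n p) (@ord_assocV m n p).
Proof.
move=> k; case: (mxtens_indexP k) => i j; case: (mxtens_indexP j) => j1 j2.
by rewrite ord_assocE ord_assocVE.
Qed.

Lemma ord_assocVK m n p : cancel (@ord_assocV m n p) (@ord_assoc m n p).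
Proof.
move=> k; case: (mxtens_indexP k) => i j; case: (mxtens_indexP i) => i1 i2.
by rewrite ord_assocVE ord_assocE.
Qed.

Lemma ord_assoc_bij m n p : bijective (@ord_assoc m n p).
Proof. exists (@ord_assocV m n p); [exact: ord_assocK | exact: ord_assocVK]. Qed.

Lemma ord_assocV_bij m n p : bijective (@ord_assocV m n p).
Proof. exists (@ord_assoc m n p); [exact: ord_assocVK | exact: ord_assocK]. Qed.

Lemma ord_swapK m n : cancel (@ord_swap m n) (@ord_swap n m).
Proof. by move=> k; case: (mxtens_indexP k) => i j; rewrite !ord_swapE. Qed.

Lemma ord_swap_bij m n : bijective (@ord_swap m n).
Proof. by exists (@ord_swap n m); exact: ord_swapK. Qed.

(* The reordering C (x) (Q (x) E) -> Q (x) (C (x) E) of tensor factors. *)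
Definition ord_perm c q e : 'I_(c * (q * e)) -> 'I_(q * (c * e)) :=
  @ord_assocV q c e \o ord_tens (@ord_swap c q) (@id 'I_e) \o @ord_assoc c q e.

Lemma ord_permE c q e i j k :
  @ord_perm c q e (mxtens_index (i, mxtens_index (j, k)))
    = mxtens_index (j, mxtens_index (i, k)).
Proof.
by rewrite /ord_perm /comp ord_assocE ord_tensE ord_swapE ord_assocVE.
Qed.

Lemma ord_perm_bij c q e : bijective (@ord_perm c q e).
Proof.
apply: bij_comp; last exact: ord_assoc_bij.
apply: bij_comp; first exact: ord_assocV_bij.
by apply: ord_tens_bij; [exact: ord_swap_bij | exists id].
Qed.

Variable K : comPzRingType.

Lemma mxsub_tens m n p q m' n' p' q' (f : 'I_m' -> 'I_m) (f' : 'I_n' -> 'I_n)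
    (g : 'I_p' -> 'I_p) (g' : 'I_q' -> 'I_q) (A : 'M[K]_(m, n)) (B : 'M[K]_(p, q)) :
  mxsub (ord_tens f g) (ord_tens f' g') (A *t B) = mxsub f f' A *t mxsub g g' B.
Proof.
apply/matrixP=> i j; case: (mxtens_indexP i) => i1 i2; case: (mxtens_indexP j) => j1 j2.
by rewrite mxE !ord_tensE !tensmxE !mxE.
Qed.

Lemma mxsub_assoc m n p m' n' p' (A : 'M[K]_(m, m')) (B : 'M[K]_(n, n')) (D : 'M[K]_(p, p')) :
  mxsub (@ord_assoc m n p) (@ord_assoc m' n' p') (A *t B *t D) = A *t (B *t D).
Proof.
apply/matrixP=> i j; case: (mxtens_indexP i) => i1 i2; case: (mxtens_indexP j) => j1 j2.
case: (mxtens_indexP i2) => i3 i4; case: (mxtens_indexP j2) => j3 j4.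
by rewrite mxE !ord_assocE !tensmxE mulrA.
Qed.

Lemma mxsub_assocV m n p m' n' p' (A : 'M[K]_(m, m')) (B : 'M[K]_(n, n')) (D : 'M[K]_(p, p')) :
  mxsub (@ord_assocV m n p) (@ord_assocV m' n' p') (A *t (B *t D)) = A *t B *t D.
Proof.
apply/matrixP=> i j; case: (mxtens_indexP i) => i1 i2; case: (mxtens_indexP j) => j1 j2.
case: (mxtens_indexP i1) => i3 i4; case: (mxtens_indexP j1) => j3 j4.
by rewrite mxE !ord_assocVE !tensmxE mulrA.
Qed.

Lemma mxsub_swap m n m' n' (A : 'M[K]_(m, m')) (B : 'M[K]_(n, n')) :
  mxsub (@ord_swap m n) (@ord_swap m' n') (B *t A) = A *t B.
Proof.
apply/matrixP=> i j; case: (mxtens_indexP i) => i1 i2; case: (mxtens_indexP j) => j1 j2.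
by rewrite mxE !ord_swapE !tensmxE mulrC.
Qed.

Lemma mxsub_perm c q e (A : 'M[K]_c) (B : 'M[K]_q) (D : 'M[K]_e) :
  mxsub (@ord_perm c q e) (@ord_perm c q e) (B *t (A *t D)) = A *t (B *t D).
Proof.
apply/matrixP=> i j; case: (mxtens_indexP i) => i1 i2; case: (mxtens_indexP j) => j1 j2.
case: (mxtens_indexP i2) => i3 i4; case: (mxtens_indexP j2) => j3 j4.
by rewrite mxE !ord_permE !tensmxE mulrCA.
Qed.

Lemma mxsubD m n m' n' (f : 'I_m' -> 'I_m) (g : 'I_n' -> 'I_n) (A B : 'M[K]_(m, n)) :
  mxsub f g (A + B) = mxsub f g A + mxsub f g B.
Proof. by apply/matrixP=> i j; rewrite !mxE. Qed.

Lemma mxsub_sum (I : finType) (P : pred I) m n m' n' (f : 'I_m' -> 'I_m) (g : 'I_n' -> 'I_n)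
    (A : I -> 'M[K]_(m, n)) :
  mxsub f g (\sum_(x | P x) A x) = \sum_(x | P x) mxsub f g (A x).
Proof. by apply/matrixP=> i j; rewrite !(mxE, summxE); apply: eq_bigr => x _; rewrite mxE. Qed.

(** Matrix units of a tensor product are tensor products of matrix units. Channels are compared this
    way, on product operators only. *)
Lemma linear_tens_ext m n p q (V : lmodType K) (f g : 'M[K]_(m * n, p * q) -> V) :
  linear f -> linear g -> (forall A B, f (A *t B) = g (A *t B)) -> f =1 g.
Proof.
move=> f_lin g_lin fg L.
pose fL : {linear _ -> V} := HB.pack f (GRing.isLinear.Build _ _ _ _ f f_lin).
pose gL : {linear _ -> V} := HB.pack g (GRing.isLinear.Build _ _ _ _ g g_lin).
rewrite -[f]/(fL : _ -> _) -[g]/(gL : _ -> _) [L]matrix_sum_delta !linear_sum.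
apply: eq_bigr => i _; rewrite !linear_sum; apply: eq_bigr => j _; rewrite !linearZ.
congr (_ *: _); case: (mxtens_indexP i) => i1 i2; case: (mxtens_indexP j) => j1 j2.
by rewrite -delta_mx_tens; exact: fg.
Qed.

End IndexBijections.

Section PartialTraces.
Variable R : realType.

Lemma ptrace1_tens m n (A : 'M[Cplx R]_m) (B : 'M[Cplx R]_n) :
  ptrace1 (A *t B) = \tr A *: B.
Proof.
apply/matrixP=> i j; rewrite !mxE mulr_suml.
by apply: eq_bigr => k _; rewrite tensmxE.
Qed.

Lemma ptrace1_linear m n : linear (@ptrace1 R m n).
Proof.
move=> c A B; apply/matrixP=> i j; rewrite !mxE mulr_sumr -big_split.
by apply: eq_bigr => k _; rewrite !mxE.
Qed.

Lemma ptrace2_linear m n : linear (@ptrace2 R m n).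
Proof.
move=> c A B; apply/matrixP=> i j; rewrite !mxE mulr_sumr -big_split.
by apply: eq_bigr => k _; rewrite !mxE.
Qed.

Lemma ptrace2_sum (I : finType) m n (A : I -> 'M[Cplx R]_(m * n)) :
  ptrace2 (\sum_x A x) = \sum_x ptrace2 (A x).
Proof.
apply/matrixP=> i j; rewrite mxE summxE; under eq_bigr do rewrite summxE.
by rewrite exchange_big; apply: eq_bigr => x _; rewrite mxE.
Qed.

Lemma ptrace2_assoc m n p (A : 'M[Cplx R]_(m * n)) (B : 'M[Cplx R]_p) :
  ptrace2 (mxsub (@ord_assoc m n p) (@ord_assoc m n p) (A *t B)) = \tr B *: ptrace2 A.
Proof.
apply/matrixP=> i j; rewrite !mxE sum_mxtens mulr_sumr; apply: eq_bigr => k _.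
rewrite mulr_suml; apply: eq_bigr => l _.
by rewrite mxE !ord_assocE tensmxE mulrC.
Qed.

Lemma ptrace2_perm c q e (A : 'M[Cplx R]_q) (B : 'M[Cplx R]_(c * e)) :
  ptrace2 (mxsub (@ord_perm c q e) (@ord_perm c q e) (A *t B)) = \tr A *: ptrace2 B.
Proof.
apply/matrixP=> i j; rewrite !mxE sum_mxtens mulr_suml; apply: eq_bigr => k _.
rewrite mulr_sumr; apply: eq_bigr => l _.
by rewrite mxE !ord_permE tensmxE.
Qed.

End PartialTraces.

Section GibbsStates.
Variables (R : realType) (beta : R).

Lemma hermitian_ham_sum m n (A : 'M[Cplx R]_m) (B : 'M[Cplx R]_n) :
  A \is hermsymmx -> B \is hermsymmx -> ham_sum A B \is hermsymmx.
Proof.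
move=> /hermsymmxP A_adj /hermsymmxP B_adj; apply/hermsymmxP.
by rewrite /ham_sum adjmxD !adjmx_tens A_adj B_adj !adjmx1.
Qed.

Lemma hamiltonian_sum m n (A : 'M[Cplx R]_m) (B : 'M[Cplx R]_n) :
  hamiltonian A -> hamiltonian B -> hamiltonian (ham_sum A B).
Proof.
by move=> [m_gt0 hA] [n_gt0 hB]; split; [rewrite muln_gt0 m_gt0 | exact: hermitian_ham_sum].
Qed.

Lemma ham_sum_fcalc m n m' n' (W : 'M[Cplx R]_(m', m)) (W' : 'M[Cplx R]_(n', n)) a b :
  unitary_map W -> unitary_map W' ->
  ham_sum (fcalc W a) (fcalc W' b)
    = fcalc (W *t W') (fun k => a (mxtens_unindex k).1 + b (mxtens_unindex k).2).
Proof.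
move=> uW uW'; rewrite /ham_sum -(fcalc1 uW) -(fcalc1 uW') !fcalc_tens fcalcD.
by apply: eq_fcalc => k; rewrite mulr1 mul1r.
Qed.

Lemma expmx_ham_sum m n (A : 'M[Cplx R]_m) (B : 'M[Cplx R]_n) (b : R) :
  A \is hermsymmx -> B \is hermsymmx ->
  expmx (b%:C *: ham_sum A B) = expmx (b%:C *: A) *t expmx (b%:C *: B).
Proof.
move=> /hermitian_fcalc[W [a [uW ->]]] /hermitian_fcalc[W' [a' [uW' ->]]].
rewrite ham_sum_fcalc // !expmx_fcalc_real // fcalc_tens.
under eq_fcalc do rewrite -rmorphD.
rewrite expmx_fcalc_real; last exact: unitary_map_tens.
by apply: eq_fcalc => k; rewrite mulrDr expRD rmorphM.
Qed.

Lemma unitary_map_colsub m n p (W : 'M[Cplx R]_(m, n)) (f : 'I_p -> 'I_n) :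
  bijective f -> unitary_map W -> unitary_map (colsub f W).
Proof. by move=> bij_f; apply: unitary_map_sub => //; exists id. Qed.

Lemma expmx_sub m n (A : 'M[Cplx R]_m) (f : 'I_n -> 'I_m) (b : R) :
  A \is hermsymmx -> bijective f ->
  expmx (b%:C *: mxsub f f A) = mxsub f f (expmx (b%:C *: A)).
Proof.
move=> /hermitian_fcalc[W [a [uW ->]]] bij_f.
rewrite fcalc_sub !expmx_fcalc_real ?fcalc_sub //.
exact: unitary_map_colsub.
Qed.

Lemma mxtrace_expmx_gt0 n (A : 'M[Cplx R]_n) (b : R) :
  hamiltonian A -> 0 < \tr (expmx (b%:C *: A)).
Proof.
move=> [n_gt0 /hermitian_fcalc[W [a [uW ->]]]].
rewrite expmx_fcalc_real // -[fcalc _ _]mulmx1 mxtrace_fcalc mulmx1.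
have [/[dup] WW -> _] := (unitary_mapP W).1 uW.
rewrite (bigD1 (Ordinal n_gt0)) //= mxE eqxx mulr1 ltr_pwDl ?ltcR ?expR_gt0 //.
by apply: sumr_ge0 => i _; rewrite mxE eqxx mulr1 lecR expR_ge0.
Qed.

Lemma mxtrace_gibbs n (A : 'M[Cplx R]_n) : hamiltonian A -> \tr (gibbs beta A) = 1.
Proof.
move=> A_ham; rewrite /gibbs mxtraceZ mulVf // gt_eqF //.
by rewrite -rmorphN; exact: mxtrace_expmx_gt0.
Qed.

Lemma gibbs_sum m n (A : 'M[Cplx R]_m) (B : 'M[Cplx R]_n) :
  A \is hermsymmx -> B \is hermsymmx ->
  gibbs beta (ham_sum A B) = gibbs beta A *t gibbs beta B.
Proof.
move=> hA hB; rewrite /gibbs -rmorphN expmx_ham_sum // mxtrace_tens invfM.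
by rewrite tensmxZl tensmxZr scalerA.
Qed.

Lemma gibbs_sub m n (A : 'M[Cplx R]_m) (f : 'I_n -> 'I_m) :
  A \is hermsymmx -> bijective f ->
  gibbs beta (mxsub f f A) = mxsub f f (gibbs beta A).
Proof.
move=> hA bij_f; rewrite /gibbs -rmorphN expmx_sub // mxtrace_mxsub //.
by apply/matrixP=> i j; rewrite !mxE.
Qed.

End GibbsStates.

(** * Control by commuting projectors *)

Section OrthogonalFamily.
Variables (R : realType) (n : nat) (I : finType) (X0 : {set I}) (M : I -> 'M[Cplx R]_n).
Hypothesis M_orth : {in X0 &, forall x y, M x *m M y = if x == y then M x else 0}.
Local Notation S := (\sum_(x in X0) M x).

Lemma mulmx_sum_orthl x : x \in X0 -> S *m M x = M x.
Proof.
move=> x_X0; rewrite mulmx_suml (bigD1 x) //= M_orth // eqxx big1 ?addr0 // => y.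
by case/andP=> y_X0 /negbTE yx; rewrite M_orth // yx.
Qed.

Lemma mulmx_sum_orthr x : x \in X0 -> M x *m S = M x.
Proof.
move=> x_X0; rewrite mulmx_sumr (bigD1 x) //= M_orth // eqxx big1 ?addr0 // => y.
by case/andP=> y_X0 /negbTE yx; rewrite M_orth // eq_sym yx.
Qed.

Lemma sum_orth_idem : S *m S = S.
Proof. by rewrite [LHS]mulmx_suml; apply: eq_bigr => x /mulmx_sum_orthr. Qed.

End OrthogonalFamily.

Section ControlledThermalOperations.
Variables (R : realType) (beta : R).

(** This is [thermal_op] with bath, environment and unitary made explicit, so that several
    operations can be said to share one bath. *)
Definition dilation n1 n2 b e (H1 : 'M[Cplx R]_n1) (H2 : 'M[Cplx R]_n2)
    (HB : 'M[Cplx R]_b) (F : 'M[Cplx R]_n1 -> 'M[Cplx R]_n2) (HE : 'M[Cplx R]_e)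
    (V : 'M[Cplx R]_(n2 * e, n1 * b)) : Prop :=
  [/\ hamiltonian HE, unitary_map V,
      V *m ham_sum H1 HB = ham_sum H2 HE *m V
    & forall L, F L = ptrace2 (V *m (L *t gibbs beta HB) *m V ^t*)].

Lemma ham_sum_sub m n n' (g : 'I_n' -> 'I_n) (A : 'M[Cplx R]_m) (B : 'M[Cplx R]_n) :
  injective g -> mxsub (ord_tens id g) (ord_tens id g) (ham_sum A B) = ham_sum A (mxsub g g B).
Proof.
move=> inj_g; rewrite /ham_sum mxsubD !mxsub_tens !mxsub1 //.
by congr (_ *t _ + _); apply/matrixP=> i j; rewrite mxE.
Qed.

Lemma ham_sum_assoc m n p (A : 'M[Cplx R]_m) (B : 'M[Cplx R]_n) (D : 'M[Cplx R]_p) :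
  mxsub (@ord_assoc m n p) (@ord_assoc m n p) (ham_sum (ham_sum A B) D)
    = ham_sum A (ham_sum B D).
Proof.
by rewrite /ham_sum tensmxDl tensmxDr !mxsubD -!tensmx11 !mxsub_assoc addrA.
Qed.

Lemma dilation_reindex n1 n2 b e b' (H1 : 'M[Cplx R]_n1) (H2 : 'M[Cplx R]_n2)
    (HB : 'M[Cplx R]_b) F (HE : 'M[Cplx R]_e) V (f : 'I_b' -> 'I_b) :
  bijective f -> HB \is hermsymmx -> dilation H1 H2 HB F HE V ->
  dilation H1 H2 (mxsub f f HB) F HE (mxsub id (ord_tens id f) V).
Proof.
move=> bij_f hB [HE_ham V_unit V_comm FE].
have id_bij m : bijective (@id 'I_m) by exists id.
have bij_1f : bijective (ord_tens (@id 'I_n1) f) by exact: ord_tens_bij.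
have sub_id m n (A : 'M[Cplx R]_(m, n)) : mxsub id id A = A by apply/matrixP=> i j; rewrite mxE.
split=> //; first exact: unitary_map_sub.
  rewrite -ham_sum_sub; last exact: bij_inj.
  by rewrite -mxsubM // V_comm (mxsubM _ _ _ _ (id_bij _)) sub_id.
move=> L; rewrite FE gibbs_sub // -{2}(sub_id _ _ L) -mxsub_tens adjmx_sub.
by rewrite -!mxsubM // sub_id.
Qed.

(** The added bath stays idle: the new unitary acts on it as the identity, its Gibbs state factors
    out of the joint one, and tracing it out gives the factor 1. *)
Lemma dilation_extend n1 n2 b e b' (H1 : 'M[Cplx R]_n1) (H2 : 'M[Cplx R]_n2)
    (HB : 'M[Cplx R]_b) F (HE : 'M[Cplx R]_e) V (HB' : 'M[Cplx R]_b') :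
  hamiltonian HB -> hamiltonian HB' -> dilation H1 H2 HB F HE V ->
  dilation H1 H2 (ham_sum HB HB') F (ham_sum HE HB')
    (mxsub (@ord_assoc n2 e b') (@ord_assoc n1 b b') (V *t 1%:M)).
Proof.
move=> HB_ham HB'_ham [HE_ham V_unit V_comm FE].
have bij1 := ord_assoc_bij n1 b b'; have bij2 := ord_assoc_bij n2 e b'.
split; first exact: hamiltonian_sum.
- apply: unitary_map_sub => //; apply: unitary_map_tens => //; exact: unitary_map1.
- rewrite -!ham_sum_assoc -!mxsubM //; congr (mxsub _ _ _).
  rewrite [ham_sum (ham_sum H1 _) _]/ham_sum [ham_sum (ham_sum H2 _) _]/ham_sum.
  by rewrite mulmxDr mulmxDl !tensmx_mul V_comm !mulmx1 !mul1mx.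
- move=> L; rewrite gibbs_sum ?HB_ham.2 ?HB'_ham.2 // -mxsub_assoc adjmx_sub -!mxsubM //.
  rewrite adjmx_tens adjmx1 !tensmx_mul mul1mx mulmx1 ptrace2_assoc.
  by rewrite mxtrace_gibbs // scale1r FE.
Qed.

(** Unitarity fixes the dimension of the environment, so operations sharing a bath have environments
    of equal dimension, as a controlled unitary requires. *)
Lemma dilation_dim n1 n2 b e (H1 : 'M[Cplx R]_n1) (H2 : 'M[Cplx R]_n2)
    (HB : 'M[Cplx R]_b) F (HE : 'M[Cplx R]_e) V :
  (0 < n2)%N -> dilation H1 H2 HB F HE V -> e = (n1 * b %/ n2)%N.
Proof.
by move=> n2_gt0 [_ /unitary_map_dim dimE _ _]; rewrite -dimE mulKn.
Qed.

Lemma common_bath (T : eqType) n1 n2 (H1 : 'M[Cplx R]_n1) (H2 : 'M[Cplx R]_n2)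
    (F : T -> 'M[Cplx R]_n1 -> 'M[Cplx R]_n2) (s : seq T) :
  (forall x, thermal_op beta H1 H2 (F x)) ->
  exists (b : nat) (HB : 'M[Cplx R]_b), hamiltonian HB /\
    forall x, x \in s -> exists e (HE : 'M[Cplx R]_e) V, dilation H1 H2 HB (F x) HE V.
Proof.
move=> F_thermal; elim: s => [|x s [b [HB [HB_ham IHs]]]].
  (* The induction starts from the trivial bath C with Hamiltonian 0. *)
  exists 1%N, 0; split=> //; split=> //; apply/hermsymmxP.
  by apply/matrixP=> i j; rewrite !mxE rmorph0.
have [b1 [e1 [HB1 [HE1 [V1 [HB1_ham HE1_ham V1_unit V1_comm F1]]]]]] := F_thermal x.
exists (b1 * b)%N, (ham_sum HB1 HB); split; first exact: hamiltonian_sum.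
move=> y; rewrite inE => /predU1P[->|/IHs [e [HE [V V_dil]]]].
  by do 3!eexists; apply: dilation_extend => //; split; [exact: HE1_ham|..]; eassumption.
(* [dilation_extend] appends the new bath [HB1] on the right, while the common bath has it on the
   left. *)
have swapE : mxsub (@ord_swap b1 b) (@ord_swap b1 b) (ham_sum HB HB1) = ham_sum HB1 HB.
  by rewrite /ham_sum mxsubD !mxsub_swap addrC.
rewrite -swapE; do 3!eexists; apply: dilation_reindex; first exact: ord_swap_bij.
  by have [] := hamiltonian_sum HB_ham HB1_ham.
by apply: dilation_extend => //; exact: V_dil.
Qed.

Lemma dilation_linear n1 n2 b e (H1 : 'M[Cplx R]_n1) (H2 : 'M[Cplx R]_n2)
    (HB : 'M[Cplx R]_b) F (HE : 'M[Cplx R]_e) V :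
  dilation H1 H2 HB F HE V -> linear F.
Proof.
move=> [_ _ _ FE] c A B; rewrite !FE tensmxDl tensmxZl mulmxDr mulmxDl.
by rewrite -scalemxAr -scalemxAl ptrace2_linear.
Qed.

(* All baths are merged into one; the unitaries V x then act between spaces of
   the same dimensions, so that sum_x P x (x) V x is a unitary whose output
   environment is Q (x) E. *)
Lemma controlled_thermal_op (T : finType) q n1 n2 (HQ : 'M[Cplx R]_q)
    (H1 : 'M[Cplx R]_n1) (H2 : 'M[Cplx R]_n2) (P : T -> 'M[Cplx R]_q)
    (F : T -> 'M[Cplx R]_n1 -> 'M[Cplx R]_n2) :
  hamiltonian HQ -> (0 < n2)%N ->
  (forall x, (P x) ^t* = P x) ->
  (forall x y, P x *m P y = if x == y then P x else 0) ->
  \sum_x P x = 1%:M ->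
  (forall x, P x *m HQ = HQ *m P x) ->
  (forall x, thermal_op beta H1 H2 (F x)) ->
  thermal_op beta (ham_sum HQ H1) H2
    (fun L : 'M[Cplx R]_(q * n1) => \sum_x F x (ptrace1 ((P x *t 1%:M) *m L))).
Proof.
move=> HQ_ham n2_gt0 P_adj P_orth P_sum P_comm F_thermal.
have [b [HB [HB_ham dil]]] := common_bath (enum T) F_thermal.
pose e := (n1 * b %/ n2)%N.
have {}dil x : exists HEV : 'M[Cplx R]_e * 'M[Cplx R]_(n2 * e, n1 * b),
    dilation H1 H2 HB (F x) HEV.1 HEV.2.
  have [|e' [HE [V V_dil]]] := dil x; first by rewrite mem_enum.
  have ee := dilation_dim n2_gt0 V_dil; rewrite -/e in ee; subst e'.
  by exists (HE, V).
have [HEV {}dil] := boolp.choice dil.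
pose HE x := (HEV x).1; pose V x := (HEV x).2.
(* The projectors sum to the identity of a nonzero space, so some x exists, and the environment of
   its dilation has positive dimension. *)
have e_gt0 : (0 < e)%N.
  have x0 : T.
    case: (pickP (@predT T)) => [x _|T0]; first exact: x.
    have := congr1 mxtrace P_sum; rewrite big_pred0 // mxtrace1 linear0 => /esym/eqP.
    by rewrite pnatr_eq0 => /eqP q0; have := HQ_ham.1; rewrite q0.
  by have [[]] := dil x0.
pose a := @ord_assocV q n1 b; pose s := @ord_perm n2 q e.
have bij_a : bijective a by exact: ord_assocV_bij.
have bij_s : bijective s by exact: ord_perm_bij.
(* The Hamiltonians [HE x] may differ although their dimensions agree, so the energy of E is made
   conditional on x, which is recorded in the factor Q of the new environment. *)
pose HEt := HQ *t 1%:M + \sum_x P x *t HE x.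
pose Vt := \sum_x P x *t V x.
have Vt_adj : Vt ^t* = \sum_x P x *t (V x) ^t*.
  by rewrite adjmx_sum; apply: eq_bigr => x _; rewrite adjmx_tens P_adj.
have PVM m n p (A : T -> 'M[Cplx R]_(m, n)) (B : T -> 'M[Cplx R]_(n, p)) :
    (\sum_x P x *t A x) *m (\sum_x P x *t B x) = \sum_x P x *t (A x *m B x).
  rewrite mulmx_suml; apply: eq_bigr => x _; rewrite mulmx_sumr (bigD1 x) //=.
  rewrite tensmx_mul P_orth eqxx big1 ?addr0 // => y /negbTE yx.
  by rewrite tensmx_mul P_orth eq_sym yx tens0mx.
have Psum1 m : \sum_x P x *t (1%:M : 'M[Cplx R]_m) = 1%:M.
  by rewrite -tensmx_suml P_sum tensmx11.
have HEt_ham : hamiltonian HEt.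
  split; first by rewrite muln_gt0 HQ_ham.1.
  apply/hermsymmxP; rewrite adjmxD adjmx_tens adjmx1 (hermsymmxP _).1 ?HQ_ham.2 //.
  rewrite adjmx_sum; congr (_ + _); apply: eq_bigr => x _; rewrite adjmx_tens P_adj.
  by rewrite (hermsymmxP (HE x)).1 //; have [[]] := dil x.
exists b, (q * e)%N, HB, HEt, (mxsub s a Vt); split=> //.
- apply: unitary_map_sub => //; apply/unitary_mapP; rewrite Vt_adj !PVM.
  split; rewrite -[RHS]Psum1; apply: eq_bigr => x _; congr (_ *t _);
  by have [_ /unitary_mapP[]] := dil x.
- have -> : ham_sum (ham_sum HQ H1) HB = mxsub a a (HQ *t 1%:M + 1%:M *t ham_sum H1 HB).
    by rewrite /ham_sum tensmxDl tensmxDr !mxsubD -!tensmx11 !mxsub_assocV addrA.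
  have -> : ham_sum H2 HEt = mxsub s s (HQ *t 1%:M + \sum_x P x *t ham_sum H2 (HE x)).
    rewrite /ham_sum; under [in RHS]eq_bigr do rewrite tensmxDr.
    rewrite big_split /= -tensmx_suml P_sum !mxsubD mxsub_sum mxsub_perm -!tensmx11 mxsub_perm.
    under [in RHS]eq_bigr do rewrite mxsub_perm.
    by rewrite -tensmx_sumr /HEt tensmxDr addrCA.
  rewrite -!mxsubM //; congr (mxsub _ _ _); rewrite mulmxDr mulmxDl; congr (_ + _).
    rewrite mulmx_suml mulmx_sumr; apply: eq_bigr => x _.
    by rewrite !tensmx_mul P_comm mulmx1 mul1mx.
  rewrite -[1%:M]P_sum tensmx_suml !PVM; apply: eq_bigr => x _.
  by have [_ _ -> _] := dil x.
have Fx_lin x : linear (F x) by exact: dilation_linear (dil x).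
apply: linear_tens_ext => [c A B|c A B|A B].
- rewrite scaler_sumr -big_split; apply: eq_bigr => x _.
  by rewrite mulmxDr -scalemxAr ptrace1_linear Fx_lin.
- by rewrite tensmxDl tensmxZl mulmxDr mulmxDl -scalemxAr -scalemxAl ptrace2_linear.
rewrite -mxsub_assocV adjmx_sub -!mxsubM // Vt_adj.
have -> : Vt *m (A *t (B *t gibbs beta HB)) *m (\sum_x P x *t (V x) ^t*)
   = \sum_x \sum_y (P x *m A *m P y) *t (V x *m (B *t gibbs beta HB) *m (V y) ^t*).
  rewrite mulmx_suml mulmx_suml; apply: eq_bigr => x _.
  by rewrite mulmx_sumr; apply: eq_bigr => y _; rewrite !tensmx_mul.
rewrite mxsub_sum ptrace2_sum; apply: eq_bigr => x _.
(* Tracing out Q kills the cross terms: tr(P x A P y) = tr(P y P x A) = 0 for x <> y. *)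
rewrite mxsub_sum ptrace2_sum (bigD1 x) //= ptrace2_perm big1 ?addr0; last first.
  move=> y /negbTE yx; rewrite ptrace2_perm mxtrace_mulC mulmxA P_orth yx mul0mx.
  by rewrite linear0 scale0r.
rewrite mxtrace_mulC mulmxA P_orth eqxx tensmx_mul mul1mx ptrace1_tens.
have [_ _ _ <-] := dil x.
pose FL : {linear _ -> _} := HB.pack (F x) (GRing.isLinear.Build _ _ _ _ (F x) (Fx_lin x)).
by rewrite -[F x]/(FL : _ -> _) linearZ.
Qed.

Lemma big_option (V : nmodType) (I : finType) (G : option I -> V) :
  \sum_o G o = (\sum_x G (Some x)) + G None.
Proof.
rewrite (bigD1 None) //= addrC; congr (_ + _).
by rewrite (reindex_omap Some id) //=; [apply: eq_bigl => x; rewrite eqxx | case].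
Qed.

Lemma projective_control_admissible q (HQ : 'M[Cplx R]_q) (I : finType) (X0 : {set I})
    (M : I -> 'M[Cplx R]_q) :
  hamiltonian HQ ->
  (forall x, x \in X0 -> (M x) ^t* = M x) ->
  {in X0 &, forall x y, M x *m M y = if x == y then M x else 0} ->
  (forall x, x \in X0 -> M x *m HQ = HQ *m M x) ->
  control_admissible beta HQ X0 M.
Proof.
move=> HQ_ham M_adj M_orth M_comm b c HB HC F Fbot HB_ham HC_ham F_thermal Fbot_thermal.
pose S := \sum_(x in X0) M x.
(* The outcome bottom becomes [None]. Indices outside [X0] receive the projector 0; they contribute
   nothing because a thermal operation sends 0 to 0, and [Fbot] serves as a default for them. *)
pose P o := if o is Some x then (if x \in X0 then M x else 0) else 1%:M - S.
pose G o := if o is Some x then (if x \in X0 then F x else Fbot) else Fbot.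
have SM := mulmx_sum_orthl M_orth; have MS := mulmx_sum_orthr M_orth.
have SS := sum_orth_idem M_orth; rewrite -/S in SM MS SS.
have G_thermal o : thermal_op beta HB HC (G o).
  by case: o => [x|] //=; case: ifP => // /F_thermal.
have S_adj : S ^t* = S by rewrite /S adjmx_sum; apply: eq_bigr => x /M_adj.
have S_comm : S *m HQ = HQ *m S.
  by rewrite /S mulmx_suml mulmx_sumr; apply: eq_bigr => x /M_comm.
have adj0 m n : (0 : 'M[Cplx R]_(m, n)) ^t* = 0 by rewrite trmx0 map_mx0.
have adjN m n (A : 'M[Cplx R]_(m, n)) : (- A) ^t* = - A ^t* by rewrite linearN map_mxN.
have := @controlled_thermal_op _ q b c HQ HB HC P G HQ_ham HC_ham.1.
have -> : (fun L : 'M[Cplx R]_(q * b) => \sum_x G x (ptrace1 ((P x *t 1%:M) *m L)))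
   = (fun L => \sum_(x in X0) F x (ptrace1 ((M x *t 1%:M) *m L))
      + Fbot (ptrace1 (((1%:M - \sum_(x in X0) M x) *t 1%:M) *m L))).
  apply: boolp.funext => L; rewrite big_option /=; congr (_ + _).
  rewrite [RHS]big_mkcond; apply: eq_bigr => x _; case: ifP => // _.
  have [b' [e [HB' [HE [V [_ _ _ _ ->]]]]]] := Fbot_thermal.
  rewrite tens0mx mul0mx.
  have -> : ptrace1 (0 : 'M[Cplx R]_(q * b)) = 0.
    by apply/matrixP=> i j; rewrite !mxE big1 // => k _; rewrite mxE.
  rewrite tens0mx mulmx0 mul0mx.
  by apply/matrixP=> i j; rewrite !mxE big1 // => k _; rewrite mxE.
apply=> //.
- case=> [x|] /=; first by case: ifP => [/M_adj|].
  by rewrite adjmxD adjN adjmx1 S_adj.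
- case=> [x|] [y|] /=.
  + rewrite (inj_eq Some_inj); case: ifP => x_X0; last by rewrite mul0mx if_same.
    case: ifP => y_X0; first exact: M_orth.
    by rewrite mulmx0; case: eqP => // xy; rewrite -xy x_X0 in y_X0.
  + by case: ifP => x_X0; rewrite ?mul0mx // mulmxBr mulmx1 MS ?subrr.
  + by case: ifP => y_X0; rewrite ?mulmx0 // mulmxBl mul1mx SM ?subrr.
  + by rewrite mulmxBl mul1mx mulmxBr mulmx1 SS subrr subr0.
- by rewrite big_option /= -big_mkcond /= addrC subrK.
- case=> [x|] /=; first by case: ifP => [/M_comm|]; rewrite ?mul0mx ?mulmx0.
  by rewrite mulmxBl mulmxBr mul1mx mulmx1 S_comm.
Qed.

End ControlledThermalOperations.

(** * Powers of matrices and sums of Hamiltonians over many copies *)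

Section Copies.
Variable R : realType.
Implicit Types d n : nat.

(** [d ^ 1] reduces to [d] and not to [d * 1], so peeling off one factor uniformly in [n] takes a
    cast; from two factors on the cast is the identity. *)
Definition ord_expS d n : 'I_(d ^ n.+1) -> 'I_(d * d ^ n) := cast_ord (expnS d n).

Lemma ord_expS_bij d n : bijective (@ord_expS d n).
Proof.
by exists (cast_ord (esym (expnS d n))) => k; [exact: cast_ordK | exact: cast_ordKV].
Qed.

Lemma ord_expS_id d n (k : 'I_(d ^ n.+2)) : ord_expS k = k :> 'I_(d * d ^ n.+1).
Proof. exact: val_inj. Qed.

Lemma ord_exp0 d (i j : 'I_(d ^ 0)) : i = j.
Proof. by move: i j => [[|//] ?] [[|//] ?]; exact: val_inj. Qed.

Lemma ord_expS1 d (k : 'I_(d ^ 1)) : (mxtens_unindex (ord_expS k)).1 = k.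
Proof. by apply: val_inj; rewrite /= divn1. Qed.

Lemma ham_sumE m n (A : 'M[Cplx R]_m) (B : 'M[Cplx R]_n) i j :
  ham_sum A B i j = A (mxtens_unindex i).1 (mxtens_unindex j).1
      * ((mxtens_unindex i).2 == (mxtens_unindex j).2)%:R
    + ((mxtens_unindex i).1 == (mxtens_unindex j).1)%:R
      * B (mxtens_unindex i).2 (mxtens_unindex j).2.
Proof. by rewrite !mxE. Qed.

Lemma tensmx_unindexE m n p q (A : 'M[Cplx R]_(m, n)) (B : 'M[Cplx R]_(p, q)) i j :
  (A *t B) i j = A (mxtens_unindex i).1 (mxtens_unindex j).1
                 * B (mxtens_unindex i).2 (mxtens_unindex j).2.
Proof. by rewrite mxE. Qed.

Lemma ntensmx_expS d (A : 'M[Cplx R]_d) n :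
  ntensmx A n.+1 = mxsub (@ord_expS d n) (@ord_expS d n) (A *t ntensmx A n).
Proof.
case: n => [|n]; apply/matrixP=> i j; rewrite [RHS]mxE tensmx_unindexE.
  rewrite !ord_expS1; set i2 := (_ _).2; set j2 := (_ _).2.
  by rewrite (ord_exp0 i2 j2) [ntensmx A 0 _ _]mxE eqxx mulr1.
by rewrite ntensmxSS tensmx_unindexE !ord_expS_id.
Qed.

Lemma ham_copies_expS d (H : 'M[Cplx R]_d) n :
  ham_copies H n.+1
    = mxsub (@ord_expS d n) (@ord_expS d n) (ham_sum H (ham_copies H n)).
Proof.
case: n => [|n]; apply/matrixP=> i j; rewrite [RHS]mxE ham_sumE.
  rewrite !ord_expS1; set i2 := (_ _).2; set j2 := (_ _).2.
  by rewrite (ord_exp0 i2 j2) [ham_copies H 0 _ _]mxE eqxx mulr1 mulr0 addr0.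
by rewrite -[ham_copies H n.+2]/(ham_sum H (ham_copies H n.+1)) ham_sumE !ord_expS_id.
Qed.

Lemma ntensmx_mul d (A B : 'M[Cplx R]_d) n :
  ntensmx (A *m B) n = ntensmx A n *m ntensmx B n.
Proof.
elim: n => [|n IHn]; first by rewrite !ntensmx0 [RHS]mulmx1.
by rewrite !ntensmx_expS -mxsubM ?tensmx_mul ?IHn //; exact: ord_expS_bij.
Qed.

Lemma ntensmx_adj d (A : 'M[Cplx R]_d) n : ntensmx (A ^t*) n = (ntensmx A n) ^t*.
Proof.
elim: n => [|n IHn]; first by rewrite !ntensmx0 [RHS]adjmx1.
by rewrite !ntensmx_expS adjmx_sub adjmx_tens IHn.
Qed.

Lemma ntensmx_1 d n : ntensmx (1%:M : 'M[Cplx R]_d) n = 1%:M.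
Proof.
elim: n => [|n IHn] //.
by rewrite ntensmx_expS IHn tensmx11 mxsub1 //; exact: bij_inj (ord_expS_bij d n).
Qed.

Lemma mxtrace_ntensmx d (A : 'M[Cplx R]_d) n : \tr (ntensmx A n) = (\tr A) ^+ n.
Proof.
elim: n => [|n IHn]; first by rewrite ntensmx0 [LHS]mxtrace1 expr0.
by rewrite ntensmx_expS mxtrace_mxsub ?mxtrace_tens ?IHn ?exprS //; exact: ord_expS_bij.
Qed.

Lemma unitary_map_ntensmx d (W : 'M[Cplx R]_d) n :
  unitary_map W -> unitary_map (ntensmx W n).
Proof.
move=> /unitary_mapP[WW W'W]; apply/unitary_mapP.
by rewrite -ntensmx_adj -!ntensmx_mul WW W'W ntensmx_1.
Qed.

Lemma hermitian_ham_copies d (H : 'M[Cplx R]_d) n :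
  H \is hermsymmx -> ham_copies H n \is hermsymmx.
Proof.
move=> H_herm; elim: n => [|n /hermsymmxP IHn]; apply/hermsymmxP.
  by apply/matrixP=> i j; rewrite !mxE rmorph0.
rewrite ham_copies_expS adjmx_sub (hermsymmxP _).1 //.
by apply: hermitian_ham_sum => //; apply/hermsymmxP.
Qed.

Lemma hamiltonian_copies d (H : 'M[Cplx R]_d) n :
  hamiltonian H -> hamiltonian (ham_copies H n).
Proof.
by move=> [d_gt0 H_herm]; split; [rewrite expn_gt0 d_gt0 | exact: hermitian_ham_copies].
Qed.

Lemma ham_copies_comm d (A B : 'M[Cplx R]_d) n :
  A *m B = B *m A -> ham_copies A n *m ham_copies B n = ham_copies B n *m ham_copies A n.
Proof.
move=> AB; elim: n => [|n IHn]; first by rewrite !mulmx0.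
rewrite !ham_copies_expS -!mxsubM; try exact: ord_expS_bij.
congr (mxsub _ _ _); rewrite /ham_sum !mulmxDl !mulmxDr !tensmx_mul.
by rewrite !mulmx1 !mul1mx AB IHn addrACA.
Qed.

(* The index k : 'I_(d ^ n) stands for the word of its n digits in base d. *)
Fixpoint digit_sum (V : nmodType) d (a : 'I_d -> V) n : 'I_(d ^ n) -> V :=
  if n is n'.+1 return 'I_(d ^ n) -> V then fun k =>
    a (mxtens_unindex (ord_expS k)).1 + digit_sum a (mxtens_unindex (ord_expS k)).2
  else fun=> 0.

Fixpoint digit_prod (K : pzSemiRingType) d (c : 'I_d -> K) n : 'I_(d ^ n) -> K :=
  if n is n'.+1 return 'I_(d ^ n) -> K then fun k =>
    c (mxtens_unindex (ord_expS k)).1 * digit_prod c (mxtens_unindex (ord_expS k)).2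
  else fun=> 1.

Lemma fcalc_rowsub n n' m (W : 'M[Cplx R]_(n, m)) c (f : 'I_n' -> 'I_n) :
  bijective f -> fcalc (rowsub f W) (c \o f) = fcalc W c.
Proof.
move=> bij_f; apply/matrixP=> i j; rewrite !fcalcE [RHS](reindex f) /=; last exact: onW_bij.
by apply: eq_bigr => k _; rewrite !mxE.
Qed.

Lemma fcalc_reindex n n' m (W : 'M[Cplx R]_(n, m)) c m' (f : 'I_n' -> 'I_n)
    (g : 'I_m' -> 'I_m) :
  bijective f -> fcalc (mxsub f g W) (c \o f) = mxsub g g (fcalc W c).
Proof. by move=> bij_f; rewrite fcalc_sub -(fcalc_rowsub _ _ bij_f) -mxsubrc. Qed.

Lemma ntensmx_fcalc d (W : 'M[Cplx R]_d) c n :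
  unitary_map W -> ntensmx (fcalc W c) n = fcalc (ntensmx W n) (digit_prod c (n := n)).
Proof.
move=> uW; elim: n => [|n IHn].
  by rewrite !ntensmx0 -[LHS](fcalc1 (unitary_map1 R 1)).
rewrite !ntensmx_expS IHn fcalc_tens -(@fcalc_reindex _ _ _ _ _ _ (@ord_expS d n)) //.
exact: ord_expS_bij.
Qed.

Lemma ham_copies_fcalc d (W : 'M[Cplx R]_d) (a : 'I_d -> R) n :
  unitary_map W ->
  ham_copies (fcalc W (fun i => (a i)%:C)) n
    = fcalc (ntensmx W n) (fun k => (digit_sum a k)%:C).
Proof.
move=> uW; elim: n => [|n IHn].
  apply/matrixP=> i j; rewrite fcalcE mxE big1 // => k _; exact: mul0r.
rewrite ham_copies_expS IHn ham_sum_fcalc //; last exact: unitary_map_ntensmx.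
rewrite -(@fcalc_reindex _ _ _ _ _ _ (@ord_expS d n)); last exact: ord_expS_bij.
rewrite ntensmx_expS; apply: eq_fcalc => k; rewrite /= rmorphD //.
Qed.

Lemma sum_digit_prod (K : comPzSemiRingType) d (q : 'I_d -> K) n :
  \sum_k digit_prod q (n := n) k = (\sum_i q i) ^+ n.
Proof.
elim: n => [|n IHn]; first by rewrite big_ord_recl big_ord0 addr0 expr0.
have bij := ord_expS_bij d n; have [f fK f'K] := bij.
rewrite exprS -IHn (reindex f); last by apply: onW_bij; exists (@ord_expS d n).
rewrite sum_mxtens mulr_suml; apply: eq_bigr => i _; rewrite mulr_sumr.
by apply: eq_bigr => j _; rewrite [LHS]/(_ * _) f'K mxtens_indexK.
Qed.

Lemma digit_prodM (K : comPzSemiRingType) d (c c' : 'I_d -> K) n k :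
  digit_prod (fun i => c i * c' i) (n := n) k = digit_prod c k * digit_prod c' k.
Proof. by elim: n k => [|n IHn] k /=; rewrite ?mulr1 // IHn mulrACA. Qed.

Lemma expR_digit_sum d (a : 'I_d -> R) n k :
  expR (digit_sum a (n := n) k) = digit_prod (fun i => expR (a i)) k.
Proof. by elim: n k => [|n IHn] k /=; rewrite ?expR0 // expRD IHn. Qed.

Lemma cis_digit_sum d (a : 'I_d -> R) n (t : R) k :
  cis (t * digit_sum a (n := n) k) = digit_prod (fun i => cis (t * a i)) k.
Proof. by elim: n k => [|n IHn] k /=; rewrite ?mulr0 ?cis0 // mulrDr cisD IHn. Qed.

Lemma digit_sumZ d (a : 'I_d -> R) n (t : R) k :
  digit_sum (fun i => t * a i) (n := n) k = t * digit_sum a k.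
Proof. by elim: n k => [|n IHn] k /=; rewrite ?mulr0 // mulrDr IHn. Qed.

Lemma digit_sumD d (a b : 'I_d -> R) n k :
  digit_sum (fun i => a i + b i) (n := n) k = digit_sum a k + digit_sum b k.
Proof. by elim: n k => [|n IHn] k /=; rewrite ?addr0 // IHn addrACA. Qed.

Lemma digit_sum_const d (b : R) n k : digit_sum (fun _ : 'I_d => b) (n := n) k = n%:R * b.
Proof. by elim: n k => [|n IHn] k /=; rewrite ?mul0r // IHn -natr1 mulrDl mul1r addrC. Qed.

Lemma digit_prod_ge0 d (q : 'I_d -> R) n k :
  (forall i, 0 <= q i) -> 0 <= digit_prod q (n := n) k.
Proof. by move=> q_ge0; elim: n k => [|n IHn] k //=; rewrite mulr_ge0. Qed.

Lemma ntensmx_diagE d (A : 'M[Cplx R]_d) n k :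
  ntensmx A n k k = digit_prod (fun i => A i i) k.
Proof.
elim: n k => [|n IHn] k; first by rewrite ntensmx0 [LHS]mxE eqxx.
by rewrite ntensmx_expS mxE /= -IHn mxE.
Qed.

Lemma digit_prod_real d (q : 'I_d -> R) n k :
  digit_prod (fun i => (q i)%:C : Cplx R) (n := n) k = (digit_prod q k)%:C.
Proof. by elim: n k => [|n IHn] k //=; rewrite IHn rmorphM. Qed.

(* The energy of a basis vector depends only on its type (occupation numbers). *)
Lemma digit_sum_type d (a : 'I_d -> R) n :
  exists kappa : 'I_(d ^ n) -> {ffun 'I_d -> 'I_n.+1},
    forall k l, kappa k = kappa l -> digit_sum a k = digit_sum a l.
Proof.
suff [cnt cntE] : exists cnt : 'I_(d ^ n) -> {ffun 'I_d -> 'I_n.+1},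
    forall k, digit_sum a k = \sum_j a j *+ cnt k j.
  by exists cnt => k l kl; rewrite !cntE kl.
elim: n => [|n [cnt cntE]].
  by exists (fun=> [ffun=> ord0]) => k; rewrite big1 // => j _; rewrite ffunE.
pose c (k : 'I_(d ^ n.+1)) j := (((mxtens_unindex (ord_expS k)).1 == j) +
  cnt (mxtens_unindex (ord_expS k)).2 j)%N.
have c_lt k j : (c k j < n.+2)%N.
  by apply: (leq_ltn_trans (leq_add (leq_b1 _) (leqnn _))); rewrite add1n ltnS ltn_ord.
exists (fun k => [ffun j => Ordinal (c_lt k j)]) => k.
rewrite [LHS]/= cntE; under [RHS]eq_bigr do rewrite ffunE /= /c mulrnDr.
rewrite big_split /=; congr (_ + _).
set i0 := (Ordinal _); rewrite (bigD1 i0) //= eqxx mulr1n big1 ?addr0 // => j.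
by rewrite eq_sym => /negbTE ->.
Qed.

Lemma split_copies d m n :
  exists r : 'I_(d ^ (m + n)) -> 'I_(d ^ m * d ^ n), [/\ bijective r,
    forall A : 'M[Cplx R]_d, ntensmx A (m + n) = mxsub r r (ntensmx A m *t ntensmx A n)
  & forall H : 'M[Cplx R]_d,
      ham_copies H (m + n) = mxsub r r (ham_sum (ham_copies H m) (ham_copies H n))].
Proof.
elim: m => [|m [r [bij_r rA rH]]].
  pose r : 'I_(d ^ n) -> 'I_(d ^ 0 * d ^ n) := cast_ord (esym (mul1n _)).
  exists r.
  have r2 k : (mxtens_unindex (r k)).2 = k.
    by apply: val_inj; rewrite /= modn_small.
  split=> [|A|H].
  - by exists (cast_ord (mul1n _)) => k; [exact: cast_ordKV | exact: cast_ordK].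
  - apply/matrixP=> i j; rewrite [RHS]mxE tensmx_unindexE !r2 [ntensmx A 0 _ _]mxE.
    set i1 := (_ _).1; set j1 := (_ _).1.
    by rewrite (ord_exp0 i1 j1) eqxx mul1r.
  - apply/matrixP=> i j; rewrite [RHS]mxE ham_sumE !r2 [ham_copies H 0 _ _]mxE mul0r add0r.
    set i1 := (_ _).1; set j1 := (_ _).1.
    by rewrite (ord_exp0 i1 j1) eqxx mul1r.
have [cV cK c'K] := ord_expS_bij d m.
have bij_cV : bijective cV by exists (@ord_expS d m).
(* Peel off one copy, split the others by [r], reassociate, and glue the first copy to the left
   block. *)
pose r' : 'I_(d ^ (m + n).+1) -> 'I_(d ^ m.+1 * d ^ n) :=
  ord_tens cV id \o @ord_assoc d (d ^ m) (d ^ n) \o ord_tens id r \o @ord_expS d (m + n).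
have id_bij p : bijective (@id 'I_p) by exists id.
have subK (X : 'M[Cplx R]_(d * d ^ m)) :
    mxsub cV cV (mxsub (@ord_expS d m) (@ord_expS d m) X) = X.
  by rewrite -mxsub_comp; apply/matrixP=> i j; rewrite mxE /= !c'K.
have sub_id p (X : 'M[Cplx R]_p) : mxsub id id X = X by apply/matrixP=> i j; rewrite mxE.
exists r'; split=> [|A|H].
- apply: bij_comp; last exact: ord_expS_bij.
  apply: bij_comp; last exact: ord_tens_bij.
  by apply: bij_comp; [exact: ord_tens_bij | exact: ord_assoc_bij].
- transitivity (ntensmx A (m + n).+1) => //; rewrite ntensmx_expS rA [RHS]mxsub_comp.
  congr (mxsub _ _ _); rewrite [RHS]mxsub_comp -[A in LHS]sub_id -mxsub_tens.
  congr (mxsub _ _ _); rewrite [RHS]mxsub_comp mxsub_tens ntensmx_expS subK.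
  by rewrite !sub_id mxsub_assoc.
- transitivity (ham_copies H (m + n).+1) => //; rewrite ham_copies_expS rH [RHS]mxsub_comp.
  congr (mxsub _ _ _); rewrite [RHS]mxsub_comp -ham_sum_sub; last exact: bij_inj.
  congr (mxsub _ _ _); rewrite [RHS]mxsub_comp -ham_sum_assoc; congr (mxsub _ _ _).
  rewrite [in RHS]/ham_sum mxsubD !mxsub_tens ham_copies_expS subK !sub_id mxsub1 //.
  exact: bij_inj bij_cV.
Qed.

(** It is essential that one bijection serves all operators: the states, the Hamiltonian and the
    projectors built on blocks of copies must be transported together. *)
Lemma regroup_copies d m n :
  exists r : 'I_(d ^ (m * n)) -> 'I_((d ^ m) ^ n), [/\ bijective r,
    forall A : 'M[Cplx R]_d, ntensmx A (m * n) = mxsub r r (ntensmx (ntensmx A m) n)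
  & forall H : 'M[Cplx R]_d,
      ham_copies H (m * n) = mxsub r r (ham_copies (ham_copies H m) n)].
Proof.
have id_bij p : bijective (@id 'I_p) by exists id.
elim: n => [|n [r [bij_r rA rH]]].
  rewrite muln0; exists (@id 'I_1); split=> [|A|H]; first by exists id.
    by apply/matrixP=> i j; rewrite !mxE.
  by apply/matrixP=> i j; rewrite !mxE.
rewrite mulnS; have [s [bij_s sA sH]] := split_copies d m (m * n).
have [cV cK c'K] := ord_expS_bij (d ^ m) n.
have bij_cV : bijective cV by exists (@ord_expS (d ^ m) n).
have subK (X : 'M[Cplx R]_(d ^ m * (d ^ m) ^ n)) :
    mxsub cV cV (mxsub (@ord_expS (d ^ m) n) (@ord_expS (d ^ m) n) X) = X.
  by rewrite -mxsub_comp; apply/matrixP=> i j; rewrite mxE /= !c'K.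
have sub_id p (X : 'M[Cplx R]_p) : mxsub id id X = X by apply/matrixP=> i j; rewrite mxE.
exists (cV \o ord_tens id r \o s); split=> [|A|H].
- by apply: bij_comp => //; apply: bij_comp => //; exact: ord_tens_bij.
- have := sA A; rewrite (rA A) => ->; move: (ntensmx A m) => B.
  rewrite [RHS]mxsub_comp; congr (mxsub _ _ _); rewrite [RHS]mxsub_comp ntensmx_expS subK.
  by rewrite mxsub_tens sub_id.
- have := sH H; rewrite (rH H) => ->; move: (ham_copies H m) => B.
  rewrite [RHS]mxsub_comp; congr (mxsub _ _ _); rewrite [RHS]mxsub_comp ham_copies_expS subK.
  by rewrite ham_sum_sub //; exact: bij_inj.
Qed.

End Copies.

(** * The stabiliser of the time orbit *)

HB.lock Definition frobip {R : realType} {m n : nat} (X Y : 'M[Cplx R]_(m, n)) : R :=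
  complex.Re (\tr (X ^t* *m Y)).

HB.lock Definition adact {R : realType} {m n : nat} (V : 'M[Cplx R]_(m, n))
    (X : 'M[Cplx R]_n) : 'M[Cplx R]_m :=
  V *m X *m V ^t*.

(** For the Hamiltonian H with eigenvalues [h] in the basis given by [W] this is exp(itH), so time t
    of the orbit corresponds to the argument [- t]. *)
HB.lock Definition propagator {R : realType} {n : nat} (W : 'M[Cplx R]_n) (h : 'I_n -> R)
    (t : R) : 'M[Cplx R]_n :=
  fcalc W (fun i => cis (t * h i)).

Section Frobenius.
Variable R : realType.

Lemma frobip_unlock m n (X Y : 'M[Cplx R]_(m, n)) :
  frobip X Y = complex.Re (\tr (X ^t* *m Y)).
Proof. by rewrite frobip.unlock. Qed.

(* The square of the Hilbert-Schmidt norm. *)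
Definition frob m n (X : 'M[Cplx R]_(m, n)) : R := frobip X X.

Lemma complex_ReD (x y : Cplx R) : complex.Re (x + y) = complex.Re x + complex.Re y.
Proof. by case: x y => [a b] [c d]. Qed.

Lemma complex_ReN (x : Cplx R) : complex.Re (- x) = - complex.Re x.
Proof. by case: x. Qed.

Lemma complex_Re_conj (x : Cplx R) : complex.Re (x^*%R) = complex.Re x.
Proof. by case: x. Qed.

Lemma complex_Re_sum (I : Type) (r : seq I) (P : pred I) (F : I -> Cplx R) :
  complex.Re (\sum_(i <- r | P i) F i) = \sum_(i <- r | P i) complex.Re (F i).
Proof. by elim/big_rec2: _ => // i y1 y2 _ <-; exact: complex_ReD. Qed.

Lemma complex_ReZ (b : R) (x : Cplx R) : complex.Re (b%:C * x) = b * complex.Re x.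
Proof. by case: x => c d; rewrite /= mul0r subr0. Qed.

Lemma frob_sumE m n (X : 'M[Cplx R]_(m, n)) :
  \tr (X ^t* *m X) = \sum_i \sum_j `|X i j| ^+ 2.
Proof.
rewrite exchange_big; apply: eq_bigr => j _; rewrite mxE; apply: eq_bigr => i _.
by rewrite !mxE normCK mulrC.
Qed.

Lemma frobE m n (X : 'M[Cplx R]_(m, n)) : \tr (X ^t* *m X) = (frob X)%:C.
Proof.
rewrite /frob frobip_unlock RRe_real // frob_sumE; apply: rpred_sum => i _; apply: rpred_sum => j _.
by rewrite rpredX // normr_real.
Qed.

Lemma frob_ge0 m n (X : 'M[Cplx R]_(m, n)) : 0 <= frob X.
Proof.
rewrite -ler0c -frobE frob_sumE; apply: sumr_ge0 => i _; apply: sumr_ge0 => j _.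
exact: exprn_ge0.
Qed.

Lemma frob_entry m n (X : 'M[Cplx R]_(m, n)) i j : `|X i j| ^+ 2 <= (frob X)%:C.
Proof.
rewrite -frobE frob_sumE (bigD1 i) //= (bigD1 j) //= -addrA lerDl addr_ge0 //.
  by apply: sumr_ge0 => k _; exact: exprn_ge0.
by apply: sumr_ge0 => k _; apply: sumr_ge0 => l _; exact: exprn_ge0.
Qed.

Lemma frob_le m n (X : 'M[Cplx R]_(m, n)) (e : R) :
  (forall i j, `|X i j| <= e%:C) -> frob X <= (m * n)%:R * e ^+ 2.
Proof.
move=> X_le; rewrite -lecR -frobE frob_sumE rmorphM rmorphXn rmorph_nat /=.
apply: (@le_trans _ _ (\sum_(i < m) \sum_(j < n) (e%:C : Cplx R) ^+ 2)).
  apply: ler_sum => i _; apply: ler_sum => j _.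
  by rewrite lerXn2r ?nnegrE // (le_trans _ (X_le i j)).
by rewrite !sumr_const !card_ord -mulrnA mulnC mulr_natl.
Qed.

Lemma frobip_sym m n (X Y : 'M[Cplx R]_(m, n)) : frobip X Y = frobip Y X.
Proof. by rewrite !frobip_unlock -complex_Re_conj -mxtrace_adj adjmxM trmxCK. Qed.

Lemma frobipDl m n (X Y Z : 'M[Cplx R]_(m, n)) : frobip (X + Y) Z = frobip X Z + frobip Y Z.
Proof. by rewrite !frobip_unlock adjmxD mulmxDl mxtraceD complex_ReD. Qed.

Lemma frobipZl m n (b : R) (X Z : 'M[Cplx R]_(m, n)) :
  frobip (b%:C *: X) Z = b * frobip X Z.
Proof.
by rewrite !frobip_unlock adjmxZ conj_Creal ?complex_real // -scalemxAl mxtraceZ complex_ReZ.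
Qed.

Lemma frobipDr m n (X Y Z : 'M[Cplx R]_(m, n)) : frobip Z (X + Y) = frobip Z X + frobip Z Y.
Proof. by rewrite ![frobip Z _]frobip_sym frobipDl. Qed.

Lemma frobipZr m n (b : R) (X Z : 'M[Cplx R]_(m, n)) :
  frobip Z (b%:C *: X) = b * frobip Z X.
Proof. by rewrite ![frobip Z _]frobip_sym frobipZl. Qed.

Lemma frobipNr m n (X Z : 'M[Cplx R]_(m, n)) : frobip Z (- X) = - frobip Z X.
Proof. by rewrite !frobip_unlock mulmxN linearN complex_ReN. Qed.

Lemma frobip_sumr (I : finType) m n (X : I -> 'M[Cplx R]_(m, n)) Z :
  frobip Z (\sum_x X x) = \sum_x frobip Z (X x).
Proof.
rewrite frobip_unlock mulmx_sumr; under [RHS]eq_bigr do rewrite frobip_unlock.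
apply: (big_morph (fun A => complex.Re (\tr A))) => [A B|].
  by rewrite mxtraceD complex_ReD.
by rewrite linear0.
Qed.

Lemma frobB m n (X Y : 'M[Cplx R]_(m, n)) :
  frob (X - Y) = frob X + frob Y - 2 * frobip X Y.
Proof.
rewrite /frob frobipDr frobipNr ![frobip (X - Y) _]frobip_sym !frobipDr !frobipNr.
rewrite (frobip_sym Y X).
by move: (frobip X X) (frobip Y Y) (frobip X Y) => x y z; ring.
Qed.

(** The parallelogram law without its term [frob (X - Y)]. It stands in for the triangle inequality
    and avoids square roots. *)
Lemma frobD_le m n (X Y : 'M[Cplx R]_(m, n)) : frob (X + Y) <= 2 * frob X + 2 * frob Y.
Proof.
have frobDE : frob (X + Y) = frob X + frob Y + 2 * frobip X Y.
  rewrite /frob frobipDr ![frobip (X + Y) _]frobip_sym !frobipDr (frobip_sym Y X).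
  by move: (frobip X X) (frobip Y Y) (frobip X Y) => x y z; ring.
have := frob_ge0 (X - Y); rewrite frobB frobDE.
by move: (frob X) (frob Y) (frobip X Y) => x y z; lra.
Qed.

Lemma frobip_CauchySchwarz m n (X Y : 'M[Cplx R]_(m, n)) :
  frobip X Y ^+ 2 <= frob X * frob Y.
Proof.
have frobZ (b : R) (Z : 'M[Cplx R]_(m, n)) : frob (b%:C *: Z) = b ^+ 2 * frob Z.
  by rewrite /frob frobipZl frobipZr mulrA expr2.
have q b : 0 <= frob X + b ^+ 2 * frob Y - 2 * (b * frobip X Y).
  by rewrite -frobZ -frobipZr -frobB frob_ge0.
have := frob_ge0 Y; rewrite le_eqVlt => /predU1P[Y0|Y_gt0].
  rewrite -Y0 mulr0; suff -> : frobip X Y = 0 by rewrite expr0n.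
  (* When [frob Y] is 0 the quadratic is affine in b, and this b makes it negative. In the other
     case below, b is the minimiser. *)
  apply/eqP/contraT => ip_neq0; have := q ((frob X + 1) / frobip X Y).
  rewrite -Y0 mulr0 addr0 divfK //; have := frob_ge0 X.
  by move: (frob X) => x; lra.
have := q (frobip X Y / frob Y).
have -> : frob X + (frobip X Y / frob Y) ^+ 2 * frob Y - 2 * (frobip X Y / frob Y * frobip X Y)
    = (frob X * frob Y - frobip X Y ^+ 2) / frob Y.
  by move: Y_gt0; move: (frob X) (frob Y) (frobip X Y) => x y z y_gt0; field; rewrite gt_eqF.
rewrite pmulr_lge0; last by rewrite invr_gt0.
by rewrite subr_ge0.
Qed.

Lemma adact_unlock m n (V : 'M[Cplx R]_(m, n)) X : adact V X = V *m X *m V ^t*.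
Proof. by rewrite adact.unlock. Qed.

Lemma adactD m n (V : 'M[Cplx R]_(m, n)) X Y : adact V (X + Y) = adact V X + adact V Y.
Proof. by rewrite !adact_unlock mulmxDr mulmxDl. Qed.

Lemma adactN m n (V : 'M[Cplx R]_(m, n)) X : adact V (- X) = - adact V X.
Proof. by rewrite !adact_unlock mulmxN mulNmx. Qed.

Lemma adact_mul m n p (V : 'M[Cplx R]_(m, n)) (W : 'M[Cplx R]_(n, p)) X :
  adact V (adact W X) = adact (V *m W) X.
Proof. by rewrite !adact_unlock adjmxM !mulmxA. Qed.

Lemma adact1 n (X : 'M[Cplx R]_n) : adact 1%:M X = X.
Proof. by rewrite !adact_unlock adjmx1 mulmx1 mul1mx. Qed.

Lemma adactZ m n (V : 'M[Cplx R]_(m, n)) (c : Cplx R) X :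
  `|c| = 1 -> adact (c *: V) X = adact V X.
Proof.
move=> c1; rewrite !adact_unlock adjmxZ -!scalemxAl -scalemxAr scalerA -normCK c1.
by rewrite expr1n scale1r.
Qed.

Lemma adact_adj m n (V : 'M[Cplx R]_(m, n)) X : (adact V X) ^t* = adact V (X ^t*).
Proof. by rewrite !adact_unlock !adjmxM trmxCK mulmxA. Qed.

Lemma adactM m n (V : 'M[Cplx R]_(m, n)) X Y : unitary_map V ->
  adact V X *m adact V Y = adact V (X *m Y).
Proof.
case/unitary_mapP=> _ V'V; rewrite !adact_unlock !mulmxA -(mulmxA (V *m X)) V'V.
by rewrite mulmx1.
Qed.

Lemma mxtrace_adact m n (V : 'M[Cplx R]_(m, n)) X : unitary_map V ->
  \tr (adact V X) = \tr X.
Proof. by case/unitary_mapP=> _ V'V; rewrite !adact_unlock mxtrace_mulC mulmxA V'V mul1mx. Qed.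

Lemma frob_adact m n (V : 'M[Cplx R]_(m, n)) X : unitary_map V -> frob (adact V X) = frob X.
Proof. by move=> uV; rewrite /frob !frobip_unlock adact_adj adactM // mxtrace_adact. Qed.

End Frobenius.

Section TimeEvolution.
Variable R : realType.

Lemma propagator_unlock n (W : 'M[Cplx R]_n) (h : 'I_n -> R) (t : R) :
  propagator W h t = fcalc W (fun i => cis (t * h i)).
Proof. by rewrite propagator.unlock. Qed.

Variables (n : nat) (W : 'M[Cplx R]_n) (h : 'I_n -> R).
Hypothesis W_unitary : unitary_map W.
Local Notation E := (propagator W h).

Lemma propagatorD s t : E s *m E t = E (s + t).
Proof.
by rewrite !propagator_unlock (fcalcM _ _ W_unitary); apply: eq_fcalc => i; rewrite mulrDl cisD.
Qed.

Lemma propagator0 : E 0 = 1%:M.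
Proof.
by rewrite propagator_unlock -(fcalc1 W_unitary); apply: eq_fcalc => i; rewrite mul0r cis0.
Qed.

Lemma propagator_adj t : (E t) ^t* = E (- t).
Proof. by rewrite !propagator_unlock fcalc_adj; apply: eq_fcalc => i; rewrite cis_conj mulNr. Qed.

Lemma propagator_unitary t : unitary_map (E t).
Proof.
by apply/unitary_mapP; rewrite propagator_adj !propagatorD addNr subrr propagator0.
Qed.

Lemma propagator_comm (G : 'M[Cplx R]_n) t :
  fcalc W (fun i => (h i)%:C) *m G = G *m fcalc W (fun i => (h i)%:C) ->
  E t *m G = G *m E t.
Proof. by rewrite propagator_unlock; apply: fcalc_comm => // i j [->]. Qed.

Lemma expmx_propagator t : expmx (('i%R * t%:C) *: fcalc W (fun i => (h i)%:C)) = E t.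
Proof. by rewrite propagator_unlock; exact: expmx_fcalc_imaginary. Qed.

Lemma adact_propagatorD s t X : adact (E s) (adact (E t) X) = adact (E (s + t)) X.
Proof. by rewrite adact_mul propagatorD. Qed.

Lemma time_orbitE (rho : 'M[Cplx R]_n) :
  time_orbit (fcalc W (fun i => (h i)%:C)) rho
    = [set adact (E (- t)) rho | t in [set: R]]%classic.
Proof.
rewrite /time_orbit; congr image; apply: boolp.funext => t.
by rewrite -mulrN -rmorphN !expmx_propagator !adact_unlock propagator_adj opprK.
Qed.

(** Balls of matrices are entrywise; [frob_le] and [frob_entry] compare them with the
    Hilbert-Schmidt norm in the two directions. *)
Lemma closure_time_orbit (rho sigma : 'M[Cplx R]_n) :
  closure (time_orbit (fcalc W (fun i => (h i)%:C)) rho) sigma <->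
  forall eps : R, 0 < eps -> exists t, frob (adact (E t) rho - sigma) < eps.
Proof.
rewrite time_orbitE; split=> [cl eps eps_gt0|cl B].
  (* The cap 1 gives [e ^+ 2 <= e]; the summand 1 keeps the denominator positive and makes the final
     bound strict. *)
  pose e := Num.min 1 (eps / ((n * n)%:R + 1)).
  have nn_gt0 : 0 < (n * n)%:R + 1 :> R by rewrite ltr_wpDl.
  have e_gt0 : 0 < e by rewrite lt_min ltr01 divr_gt0.
  have eC_gt0 : 0 < (e%:C : Cplx R) by rewrite ltcR.
  have [_ [[t _ <-] []]] := cl _ (nbhsx_ballx sigma (e%:C : Cplx R) eC_gt0).
  move=> _ near_t; exists (- t); rewrite -[X in frob X]opprB.
  have -> : frob (- (sigma - adact (E (- t)) rho)) = frob (sigma - adact (E (- t)) rho).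
    by rewrite /frob frobipNr frobip_sym frobipNr opprK.
  apply: (@le_lt_trans _ _ ((n * n)%:R * e ^+ 2)).
    by apply: frob_le => i j; have := near_t i j; rewrite /ball /= !mxE => /ltW.
  have e1 : e <= 1 by rewrite ge_min lexx.
  have e2 : e * ((n * n)%:R + 1) <= eps by rewrite -ler_pdivlMr // ge_min lexx orbT.
  have : (n * n)%:R * e ^+ 2 <= (n * n)%:R * e.
    by rewrite ler_wpM2l // expr2 ger_pMl.
  move: e2; rewrite mulrDr mulr1; lra.
move=> /nbhs_ballP[e /= e_gt0 eB].
have /complex_realP[e' e'E] : e \is Num.real by apply: gtr0_real.
rewrite e'E ltcR in e_gt0 eB.
have [t near_t] := cl (e' ^+ 2) (exprn_gt0 _ e_gt0).
exists (adact (E t) rho); split; first by exists (- t); rewrite ?opprK.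
apply: eB; split; first by rewrite ltcR.
move=> i j; rewrite /ball /= distrC.
have e'_ge0 : 0 <= (e'%:C : Cplx R) by rewrite lecR ltW.
have near_C : (frob (adact (E t) rho - sigma))%:C < (e' ^+ 2)%:C by rewrite ltcR.
have := le_lt_trans (frob_entry _ i j) near_C.
by rewrite rmorphXn !mxE ltr_pXn2r ?nnegrE.
Qed.

End TimeEvolution.

Section ProjectiveOrbit.
Variables (R : realType) (gT : finGroupType) (d : nat).
Variables (U : gT -> 'M[Cplx R]_d) (W : 'M[Cplx R]_d) (h : 'I_d -> R) (rho : 'M[Cplx R]_d).
Local Notation H := (fcalc W (fun i => (h i)%:C)).
Hypothesis U_rep : proj_unitary_rep U.
Hypothesis W_unitary : unitary_map W.
Hypothesis U_comm : forall g, U g *m H = H *m U g.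
Local Notation E := (propagator W h).
Local Notation K := (time_orbit_stab U H rho).

Lemma rep_unitary g : unitary_map (U g).
Proof. exact/unitary_map_square/U_rep.1. Qed.

Lemma adact_repM g k X : adact (U g) (adact (U k) X) = adact (U (g * k)%g) X.
Proof. by rewrite adact_mul; have [c c1 ->] := U_rep.2 g k; rewrite adactZ. Qed.

(** Projectivity gives U(1) U(1) = c U(1); cancelling one factor shows that U(1) is the phase c,
    which conjugation does not see. *)
Lemma adact_rep1 X : adact (U 1%g) X = X.
Proof.
have [c c1] := U_rep.2 1%g 1%g; rewrite mulg1 => U11.
have [_ V'V] := (unitary_mapP _).1 (rep_unitary 1).
have -> : U 1%g = c *: 1%:M.
  by rewrite -V'V -[LHS]mul1mx -V'V -mulmxA U11 -scalemxAr.
by rewrite adactZ // adact1.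
Qed.

Lemma rep_propagator_comm g t : U g *m E t = E t *m U g.
Proof. by rewrite (propagator_comm W_unitary) // U_comm. Qed.

Lemma adact_rep_propagator g t X : adact (U g) (adact (E t) X) = adact (E t) (adact (U g) X).
Proof. by rewrite !adact_mul rep_propagator_comm. Qed.

Lemma stabP g : reflect
  (forall eps : R, 0 < eps -> exists t, frob (adact (E t) rho - adact (U g) rho) < eps) (g \in K).
Proof.
have orbitP := closure_time_orbit h W_unitary rho (adact (U g) rho).
rewrite inE adact_unlock; rewrite adact_unlock in orbitP.
by apply: (iffP (asboolP _)) => /orbitP.
Qed.

(** Evolutions commute with every [U g], so a time approximating g and one approximating k add up to
    a time approximating their product. In a finite group closure under products and the unit
    suffice. *)
Lemma time_orbit_stab_group : group_set K.
Proof.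
apply/group_setP; split=> [|g k /stabP gK /stabP kK].
  apply/stabP => eps eps_gt0; exists 0.
  rewrite propagator0 // adact1 adact_rep1 subrr /frob frobip_unlock mulmx0 linear0 //.
(* [frobD_le] doubles each of the two errors, hence the quarter. *)
apply/stabP => eps eps_gt0; have eps4 : 0 < eps / 4 by lra.
have [s gs] := gK _ eps4; have [t kt] := kK _ eps4; exists (t + s).
rewrite -adact_propagatorD // -adact_repM.
have -> : adact (E t) (adact (E s) rho) - adact (U g) (adact (U k) rho)
  = adact (E t) (adact (E s) rho - adact (U g) rho)
    + adact (U g) (adact (E t) rho - adact (U k) rho).
  by rewrite !(adactD, adactN) (adact_rep_propagator g t rho) addrA subrK.
apply: le_lt_trans (frobD_le _ _) _.
rewrite (frob_adact _ (propagator_unitary h W_unitary t)) (frob_adact _ (rep_unitary g)).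
move: gs kt; move: (frob _) (frob _) => x y; lra.
Qed.

End ProjectiveOrbit.

(** * Pinching *)

Section TrigonometricMean.
Variable R : realType.

(* Averaging over t and t + pi / w kills the frequency w without changing the
   constant term, so the constant term is bounded by some value of the sum. *)
Lemma trig_mean (I : finType) (w : I -> R) (a : I -> Cplx R) :
  exists t, complex.Re (\sum_(i | w i == 0) a i) <= complex.Re (\sum_i a i * cis (w i * t)).
Proof.
(* The induction runs over a list containing every nonzero frequency with nonzero coefficient;
   averaging changes the coefficients, so they are generalised too. *)
suff main (L : seq R) (b : I -> Cplx R) :
    (forall i, b i != 0 -> w i != 0 -> w i \in L) ->
    exists t, complex.Re (\sum_(i | w i == 0) b i) <= complex.Re (\sum_i b i * cis (w i * t)).
  by apply: (main [seq w i | i <- enum I]) => i _ _; rewrite map_f ?mem_enum.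
elim: L b => [|l L IHL] b bL.
  exists 0; rewrite big_mkcond le_eqVlt; apply/orP; left; apply/eqP; congr complex.Re.
  apply: eq_bigr => i _; rewrite mulr0 cis0 mulr1; case: eqP => // /eqP wi.
  by apply/esym/eqP; apply: contraT => /bL/(_ wi).
have [l0|l_neq0] := eqVneq l 0.
  by apply: IHL => i bi wi; have := bL i bi wi; rewrite inE l0 (negPf wi).
pose c i := (2^-1)%:C * (b i * (1 + cis (w i * (pi / l)))).
have [|t IHt] := IHL c.
  move=> i ci wi; have bi : b i != 0 by apply: contraNneq ci; rewrite /c => ->; rewrite mul0r mulr0.
  have := bL i bi wi; rewrite inE => /predU1P[wl|//]; move: ci.
  by rewrite /c wl (mulrC l) (divfK l_neq0) cispi subrr !mulr0 eqxx.
have c0 : \sum_(i | w i == 0) c i = \sum_(i | w i == 0) b i.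
  apply: eq_bigr => i /eqP wi; rewrite /c wi mul0r cis0 -[1 + 1]/(2%:R) mulrCA.
  by rewrite -(rmorph_nat (real_complex R) 2) -rmorphM mulVf ?pnatr_eq0 // rmorph1 mulr1.
have cE : \sum_i c i * cis (w i * t) = (2^-1)%:C *
    (\sum_i b i * cis (w i * t) + \sum_i b i * cis (w i * (t + pi / l))).
  rewrite -big_split mulr_sumr; apply: eq_bigr => i _ /=.
  by rewrite /c (mulrDr (w i)) cisD; ring.
rewrite c0 cE complex_ReZ complex_ReD in IHt.
have [le_t|lt_t] := leP (complex.Re (\sum_(i | w i == 0) b i))
                        (complex.Re (\sum_i b i * cis (w i * t))); first by exists t.
exists (t + pi / l); move: IHt lt_t.
by move: (complex.Re _) (complex.Re _) (complex.Re _) => x y z; lra.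
Qed.

End TrigonometricMean.

Definition mask {R : realType} {n : nat} (lam : 'I_n -> R) (X : 'M[Cplx R]_n) :
    'M[Cplx R]_n :=
  \matrix_(i, j) if lam i == lam j then X i j else 0.

(** The pinching sum_e Pi_e X Pi_e, where Pi_e are the spectral projectors of the Hamiltonian with
    eigenvalues [lam] in the basis given by [W]. *)
HB.lock Definition pinch {R : realType} {n : nat} (W : 'M[Cplx R]_n) (lam : 'I_n -> R)
    (X : 'M[Cplx R]_n) : 'M[Cplx R]_n :=
  W ^t* *m mask lam (adact W X) *m W.

Section Pinching.
Variables (R : realType) (n : nat) (W : 'M[Cplx R]_n) (lam : 'I_n -> R).
Hypothesis W_unitary : unitary_map W.
Local Notation E := (propagator W lam).

Lemma pinch_comm X :
  pinch W lam X *m fcalc W (fun i => (lam i)%:C) = fcalc W (fun i => (lam i)%:C) *m pinch W lam X.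
Proof.
have [WW _] := (unitary_mapP _).1 W_unitary.
set M := mask lam (adact W X); set D := diag_mx (\row_i (lam i)%:C).
have MD : M *m D = D *m M.
  apply/matrixP=> i j; rewrite mul_mx_diag mul_diag_mx !mxE.
  by case: eqP => [->|_]; rewrite ?mulr0 ?mul0r // mulrC.
rewrite !pinch.unlock -/M fcalc_unlock -/D.
transitivity (W ^t* *m (M *m D) *m W).
  by rewrite !mulmxA -(mulmxA _ W) WW mulmx1.
by rewrite MD !mulmxA -(mulmxA _ W) WW mulmx1.
Qed.

Lemma pinch_adj X : (pinch W lam X) ^t* = pinch W lam (X ^t*).
Proof.
rewrite !pinch.unlock !adjmxM trmxCK mulmxA -adact_adj; congr (_ *m _ *m _).
apply/matrixP=> i j; rewrite adjmxE !mxE eq_sym.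
by case: eqP => _; rewrite ?rmorph0.
Qed.

Lemma mxtrace_adactM X Y : \tr (X *m Y) = \tr (adact W X *m adact W Y).
Proof. by rewrite adactM // mxtrace_adact. Qed.

Lemma mxtrace_pinch X Y : \tr (pinch W lam X *m Y)
  = \sum_i \sum_(j | lam i - lam j == 0) adact W X i j * adact W Y j i.
Proof.
have [WW _] := (unitary_mapP _).1 W_unitary.
have maskE : adact W (pinch W lam X) = mask lam (adact W X).
  by rewrite [LHS]adact_unlock !pinch.unlock !mulmxA WW mul1mx -mulmxA WW mulmx1.
rewrite mxtrace_adactM maskE; apply: eq_bigr => i _; rewrite mxE [RHS]big_mkcond.
by apply: eq_bigr => j _; rewrite mxE subr_eq0; case: eqP; rewrite ?mul0r.
Qed.

Lemma mxtrace_propagator X Y t : \tr (X *m adact (E (- t)) Y)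
  = \sum_i \sum_j adact W X i j * adact W Y j i * cis ((lam i - lam j) * t).
Proof.
have [WW _] := (unitary_mapP _).1 W_unitary.
have WE s : W *m E s = diag_mx (\row_i cis (s * lam i)) *m W.
  by rewrite propagator_unlock fcalc_unlock !mulmxA WW mul1mx.
have EW : adact W (adact (E (- t)) Y) = diag_mx (\row_i cis (- t * lam i)) *m
    adact W Y *m diag_mx (\row_i cis (t * lam i)).
  rewrite adact_mul WE -adact_mul [LHS]adact_unlock; congr (_ *m _).
  apply/matrixP=> i j; rewrite adjmxE !mxE eq_sym.
  by case: eqP => [->|_]; rewrite ?mulr0n ?rmorph0 // !mulr1n cis_conj mulNr opprK.
rewrite mxtrace_adactM EW.
apply: eq_bigr => i _; rewrite mxE; apply: eq_bigr => j _.
rewrite mul_mx_diag mxE mul_diag_mx !mxE mulrAC -cisD mulrA [RHS]mulrAC.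
by congr (_ * cis _ * _); ring.
Qed.

(** The overlap at time t is a trigonometric polynomial with frequencies [lam i - lam j], and the
    left-hand side is its constant term. *)
Lemma pinch_le X Y :
  exists t, complex.Re (\tr (pinch W lam X *m Y)) <= complex.Re (\tr (X *m adact (E t) Y)).
Proof.
have [t] := trig_mean (fun s : 'I_n * 'I_n => lam s.1 - lam s.2)
  (fun s => adact W X s.1 s.2 * adact W Y s.2 s.1).
rewrite -(pair_big_dep predT (fun i j => lam i - lam j == 0)
  (fun i j => adact W X i j * adact W Y j i)) /=.
rewrite -(pair_big predT predT
  (fun i j => adact W X i j * adact W Y j i * cis ((lam i - lam j) * t))) /=.
by rewrite -mxtrace_pinch -mxtrace_propagator; exists (- t).
Qed.

(** Expand the nonnegative sum of [frob (M x - M y)] over all pairs. *)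
Lemma frob_sum_le (T : finType) p q (M : T -> 'M[Cplx R]_(p, q)) :
  frob (\sum_x M x) <= #|T|%:R * \sum_x frob (M x).
Proof.
have : 0 <= \sum_x \sum_y frob (M x - M y).
  by apply: sumr_ge0 => x _; apply: sumr_ge0 => y _; exact: frob_ge0.
have -> : \sum_x \sum_y frob (M x - M y)
   = 2 * (#|T|%:R * \sum_x frob (M x)) - 2 * frob (\sum_x M x).
  have sum1 : \sum_x \sum_(y : T) frob (M x) = #|T|%:R * \sum_x frob (M x).
    by rewrite mulr_sumr; apply: eq_bigr => x _; rewrite sumr_const mulr_natl.
  have sum2 : \sum_(x : T) \sum_y frob (M y) = #|T|%:R * \sum_x frob (M x).
    by rewrite sumr_const mulr_natl.
  have sum3 : \sum_x \sum_y 2 * frobip (M x) (M y) = 2 * frob (\sum_x M x).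
    rewrite /frob frobip_sumr mulr_sumr; apply: eq_bigr => x _.
    by rewrite frobip_sym frobip_sumr mulr_sumr.
  under eq_bigr => x _ do (under eq_bigr do rewrite frobB; rewrite sumrB big_split /=).
  by rewrite sumrB big_split /= sum1 sum2 sum3; ring.
by move: (#|T|%:R * _) (frob _) => x y; lra.
Qed.

Lemma frob_gram_sym p q (D : 'M[Cplx R]_(p, q)) : frob (D *m D ^t*) = frob (D ^t* *m D).
Proof.
rewrite /frob !frobip_unlock !adjmxM !trmxCK.
by rewrite mxtrace_mulC !mulmxA mxtrace_mulC !mulmxA.
Qed.

(* The pinching inequality: X is split into its blocks along the classes of kappa,
   and the squared norm of a sum of #|T| terms is at most #|T| times the sum of
   their squared norms. *)
Lemma pinch_ge (T : finType) (kappa : 'I_n -> T) p (B : 'M[Cplx R]_(p, n)) X :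
  (forall i j, kappa i = kappa j -> lam i = lam j) -> X = B ^t* *m B ->
  frob X <= #|T|%:R * complex.Re (\tr (pinch W lam X *m X)).
Proof.
move=> kappa_lam XE.
have [D DE] : exists D : 'M[Cplx R]_(p, n), adact W X = D ^t* *m D.
  by exists (B *m W ^t*); rewrite adact_unlock adjmxM trmxCK XE !mulmxA.
have D_adj i j : (D ^t* *m D) j i = ((D ^t* *m D) i j)^*%R.
  by have := adjmxE (D ^t* *m D) j i; rewrite adjmxM trmxCK.
pose P x : 'M[Cplx R]_n := diag_mx (\row_i (kappa i == x)%:R).
have P_sum : \sum_x P x = 1%:M.
  apply/matrixP=> i j; rewrite summxE mxE (bigD1 (kappa i)) //= big1 ?addr0.
    by rewrite !mxE eqxx.
  by move=> x /negPf; rewrite !mxE eq_sym => ->; rewrite mul0rn.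
have P_adj x : (P x) ^t* = P x.
  apply/matrixP=> i j; rewrite adjmxE !mxE rmorphMn /= rmorph_nat [j == i]eq_sym.
  by case: (i =P j) => [->|_].
(* The two Gram matrices of [D] have the same norm, and in the one formed on the other side the
   partition of the identity can be inserted in the middle: this gives #|T| terms instead of one for
   each pair of classes. *)
have frobX : frob X = frob (\sum_x D *m P x *m D ^t*).
  rewrite -mulmx_suml -mulmx_sumr P_sum mulmx1 frob_gram_sym -DE.
  by rewrite frob_adact.
(* The norm of the x-th term sums the squared entries of the diagonal block of class x; the pinching
   retains these blocks because [lam] is constant on classes. *)
have frobP x : (frob (D *m P x *m D ^t*))%:C
    = \sum_i \sum_j if (kappa i == x) && (kappa j == x) then `|(D ^t* *m D) i j| ^+ 2 else 0.
  rewrite -frobE !adjmxM trmxCK P_adj.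
  transitivity (\tr (P x *m (D ^t* *m D) *m (P x *m (D ^t* *m D)))).
    by rewrite -!mulmxA mxtrace_mulC !mulmxA.
  apply: eq_bigr => i _; rewrite mxE; apply: eq_bigr => j _.
  have PE (Y : 'M[Cplx R]_n) k l : (P x *m Y) k l = (kappa k == x)%:R * Y k l.
    by rewrite mul_diag_mx !mxE.
  rewrite !PE (D_adj i j) normCK.
  by do 2!case: eqP => _; rewrite /= ?mul1r ?mul0r ?mulr0.
rewrite frobX (le_trans (frob_sum_le _)) // ler_wpM2l // -lecR rmorph_sum.
rewrite (eq_bigr _ (fun x _ => frobP x)).
have trE : \tr (pinch W lam X *m X)
    = \sum_i \sum_(j | lam i - lam j == 0) `|(D ^t* *m D) i j| ^+ 2.
  rewrite mxtrace_pinch DE; apply: eq_bigr => i _; apply: eq_bigr => j _.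
  by rewrite (D_adj i j) normCK.
rewrite RRe_real; last first.
  by rewrite trE; apply: rpred_sum => i _; apply: rpred_sum => j _; rewrite rpredX // normr_real.
rewrite trE exchange_big; apply: ler_sum => i _.
rewrite exchange_big [leRHS]big_mkcond; apply: ler_sum => j _.
rewrite (bigD1 (kappa i)) //= eqxx big1 => [|x /negPf]; last by rewrite eq_sym => ->.
rewrite addr0; case: eqP => [/esym/kappa_lam ->|_]; first by rewrite subrr eqxx.
by case: ifP => // _; exact: exprn_ge0.
Qed.

End Pinching.

(** * An observable separating the cosets of the stabiliser *)

Section Preliminaries.
Variable R : realType.

Lemma geometric_beats_polynomial (r : R) d : 0 <= r -> r < 1 ->
  exists2 p, (0 < p)%N & r ^+ p * (p.+1 ^ d)%:R < 1.
Proof.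
move=> r_ge0 r_lt1; pose a := 1 - r; have a_gt0 : 0 < a by rewrite subr_gt0.
(* Chosen so that the term of degree d+1 in the exponential series at a y, multiplied by exp(- a),
   equals y^d (C y); p is then taken so large that C y > 1. *)
pose C := expR (- a) * (a ^+ d.+1 / d.+1`!%:R).
have C_gt0 : 0 < C by rewrite !mulr_gt0 ?expR_gt0 ?exprn_gt0 // invr_gt0 ltr0n fact_gt0.
pose p := (Num.bound C^-1).+1; exists p => //; pose y : R := p.+1%:R.
have y_gt0 : 0 < y by rewrite ltr0n.
have Cy : 1 < C * y.
  rewrite -ltr_pdivrMl // mulr1; apply: lt_le_trans (archi_boundP _) _.
    by rewrite invr_ge0 ltW.
  by rewrite ler_nat /p -addn2 leq_addr.
have rp : r ^+ p <= expR (- (a * p%:R)).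
  rewrite -mulNr expRM_natr lerXn2r ?nnegrE ?expR_ge0 //.
  by have := expR_ge1Dx (- a); rewrite /a opprB addrCA subrr addr0.
have yd : y ^+ d < expR (a * p%:R).
  have -> : a * p%:R = - a + a * y by rewrite /y -natr1; ring.
  rewrite expRD; have ay_ge0 : 0 <= a * y by rewrite mulr_ge0 // ltW.
  have := expR_ge1Dxn d ay_ge0 => eay.
  apply: (@lt_le_trans _ _ (expR (- a) * ((a * y) ^+ d.+1 / d.+1`!%:R))).
    have -> : expR (- a) * ((a * y) ^+ d.+1 / d.+1`!%:R) = y ^+ d * (C * y).
      by rewrite /C exprMn !exprSr; ring.
    by rewrite ltr_pMr // exprn_gt0.
  by rewrite ler_wpM2l ?expR_ge0 // (le_trans _ eay) // lerDr.
rewrite natrX; apply: le_lt_trans (ler_wpM2r (exprn_ge0 _ (ltW y_gt0)) rp) _.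
by rewrite expRN mulrC ltr_pdivrMr ?expR_gt0 // mul1r.
Qed.

Lemma poly_nonroot (Q : {poly R}) : Q != 0 -> exists s, Q.[s] != 0.
Proof.
move=> Q_neq0; pose rs : seq R := [seq i%:R | i <- iota 0 (size Q)].
have [/allP rs_roots|/allPn[s _ Qs]] := boolP (all (root Q) rs); last by exists s.
have rs_uniq : uniq rs by rewrite map_inj_uniq ?iota_uniq //; exact: mulrIn (oner_neq0 R).
have := max_poly_roots Q_neq0 _ rs_uniq.
by rewrite size_map size_iota ltnn => /(_ (introT allP rs_roots)).
Qed.

(** It shows that the overlap of two positive operators is real and nonnegative, so that powers of
    overlaps can be compared. *)
Lemma mxtrace_gram p n (B D : 'M[Cplx R]_(p, n)) :
  \tr (B ^t* *m B *m (D ^t* *m D)) = (frob (B *m D ^t*))%:C.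
Proof. by rewrite -frobE adjmxM trmxCK mulmxA mxtrace_mulC !mulmxA. Qed.

Lemma gram_adact m n p (B : 'M[Cplx R]_(p, n)) (V : 'M[Cplx R]_(m, n)) :
  adact V (B ^t* *m B) = (B *m V ^t*) ^t* *m (B *m V ^t*).
Proof. by rewrite adact_unlock adjmxM trmxCK !mulmxA. Qed.

Lemma gram_ntensmx d (B : 'M[Cplx R]_d) p :
  ntensmx (B ^t* *m B) p = (ntensmx B p) ^t* *m ntensmx B p.
Proof. by rewrite ntensmx_mul ntensmx_adj. Qed.

Lemma adact_ntensmx d (V X : 'M[Cplx R]_d) p :
  adact (ntensmx V p) (ntensmx X p) = ntensmx (adact V X) p.
Proof. by rewrite !adact_unlock !ntensmx_mul ntensmx_adj. Qed.

Lemma frob_ntensmx d (X : 'M[Cplx R]_d) p : frob (ntensmx X p) = frob X ^+ p.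
Proof.
apply: complexI; rewrite -frobE -ntensmx_adj -ntensmx_mul mxtrace_ntensmx frobE.
by rewrite rmorphXn.
Qed.

Lemma propagator_ntensmx d (W : 'M[Cplx R]_d) h p t : unitary_map W ->
  propagator (ntensmx W p) (fun k => digit_sum h k) t = ntensmx (propagator W h t) p.
Proof.
move=> uW; rewrite !propagator_unlock ntensmx_fcalc //.
by apply: eq_fcalc => k; rewrite cis_digit_sum.
Qed.

(** Bernoulli's inequality for 1 - x / c, multiplied by c^p so that no division occurs. *)
Lemma bernoulli_exprB (c x : R) p : 0 <= x -> x <= c ->
  c ^+ p - (p%:R * c ^+ p.-1) * x <= (c - x) ^+ p.
Proof.
move=> x_ge0 xc; have c_ge0 : 0 <= c by exact: le_trans xc.
elim: p => [|p IHp]; first by rewrite !expr0 !mul0r subr0.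
have : (c - x) * (c ^+ p - p%:R * c ^+ p.-1 * x) <= (c - x) ^+ p.+1.
  by rewrite exprS ler_wpM2l // subr_ge0.
apply: le_trans; case: p {IHp} => [|p]; first by rewrite expr1 !expr0; lra.
rewrite /= !exprS -natr1 -[X in X <= _]addr0 -subr_ge0.
set y := c ^+ p; have y_ge0 : 0 <= y by exact: exprn_ge0.
set q := p.+1%:R : R; have q_ge0 : 0 <= q by rewrite ler0n.
have -> : (c - x) * (c * y - q * y * x) - (c * (c * y) - (q + 1) * (c * y) * x + 0)
  = q * y * x ^+ 2 by ring.
by rewrite !mulr_ge0 // exprn_ge0.
Qed.

End Preliminaries.

Section Separation.
Variables (R : realType) (gT : finGroupType) (d : nat).
Variables (U : gT -> 'M[Cplx R]_d) (W : 'M[Cplx R]_d) (h : 'I_d -> R).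
Variables (B rho : 'M[Cplx R]_d).
Local Notation H := (fcalc W (fun i => (h i)%:C)).
Hypothesis U_rep : proj_unitary_rep U.
Hypothesis W_unitary : unitary_map W.
Hypothesis U_comm : forall g, U g *m H = H *m U g.
Hypothesis rhoE : rho = B ^t* *m B.
Hypothesis rho_tr : \tr rho = 1.
Local Notation E := (propagator W h).
Local Notation K := (time_orbit_stab U H rho).
Local Notation sigma g := (adact (U g) rho).
Local Notation c := (frob rho).

Let ov n (X Y : 'M[Cplx R]_n) : R := complex.Re (\tr (X *m Y)).

Definition orbit_value p (A : 'M[Cplx R]_(d ^ p)) (g : gT) : R :=
  complex.Re (\tr (A *m ntensmx (adact (U g) rho) p)).

Let uU g : unitary_map (U g) := rep_unitary U_rep g.
Let uE t : unitary_map (E t) := propagator_unitary h W_unitary t.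

Let evol := adact_rep_propagator W_unitary U_comm.

Lemma purity_gt0 : 0 < c.
Proof.
rewrite lt_neqAle frob_ge0 andbT eq_sym; apply/eqP => c0; have := rho_tr.
rewrite /mxtrace big1 => [/esym/eqP|i _]; first by rewrite oner_eq0.
have := frob_entry rho i i; rewrite c0 rmorph0 => le0.
have : `|rho i i| ^+ 2 == 0 by rewrite eq_le le0 exprn_ge0.
by rewrite expf_eq0 normr_eq0 => /andP[_ /eqP].
Qed.

Lemma rho_adj : rho ^t* = rho.
Proof. by rewrite rhoE adjmxM trmxCK. Qed.

(** Conjugates of [rho] share its purity c, so being close in norm is the same as having overlap
    close to c. *)
Lemma ov_frob_sub (X Y : 'M[Cplx R]_d) : X ^t* = X -> frob X = c -> frob Y = c ->
  frob (X - Y) = 2 * (c - ov X Y).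
Proof. by move=> X_adj Xc Yc; rewrite frobB Xc Yc frobip_unlock X_adj -/(ov X Y); ring. Qed.

Lemma nonstab_gap g : g \notin K ->
  exists2 r, 0 <= r < 1 & forall t, ov (adact (E t) rho) (sigma g) <= c * r.
Proof.
have c_gt0 := purity_gt0.
move=> /negP gK.
have /existsNP[eps /not_implyP[eps_gt0 far]] : ~ forall eps : R, 0 < eps ->
    exists t, frob (adact (E t) rho - sigma g) < eps.
  by move=> near_g; apply: gK; apply/(stabP _ _ _ W_unitary).
(* The overlap is at most c - eps / 2, which is c times the second argument; the maximum ensures 0
   <= r even if eps exceeds 2 c. *)
exists (Num.max 0 (1 - eps / (2 * c))).
  rewrite le_max lexx /= gt_max ltr01 /= ltrBlDr ltrDl divr_gt0 //.
  by rewrite mulr_gt0.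
move=> t; have far_t : eps <= frob (adact (E t) rho - sigma g).
  by rewrite leNgt; apply/negP => near_t; apply: far; exists t.
have rho_t_adj : (adact (E t) rho) ^t* = adact (E t) rho by rewrite adact_adj rho_adj.
rewrite (ov_frob_sub rho_t_adj (frob_adact _ (uE t)) (frob_adact _ (uU g))) in far_t.
apply: (@le_trans _ _ (c * (1 - eps / (2 * c)))); last first.
  by rewrite ler_wpM2l ?(ltW c_gt0) // le_max lexx orbT.
have -> : c * (1 - eps / (2 * c)) = c - eps / 2 by field; rewrite gt_eqF.
by move: far_t; move: (ov _ _) => x; lra.
Qed.

Lemma uniform_gap : exists2 r, 0 <= r < 1 &
  forall g t, g \notin K -> ov (adact (E t) rho) (sigma g) <= c * r.
Proof.
have /boolp.choice[f fP] : forall g, exists r, (0 <= r < 1) &&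
    `[< g \notin K -> forall t, ov (adact (E t) rho) (sigma g) <= c * r >].
  move=> g; have [gK|/nonstab_gap[r r01 rP]] := boolP (g \in K).
    by exists 0; rewrite lexx ltr01; apply/asboolP.
  by exists r; rewrite r01; apply/asboolP.
exists (\big[Num.max/0]_g f g).
  rewrite bigmax_idl le_max lexx /= -bigmax_idl.
  apply/bigmax_ltP; split=> [|g _]; first exact: ltr01.
  by have /andP[/andP[]] := fP g.
move=> g t gK; have /andP[_ /asboolP/(_ gK)/(_ t)] := fP g.
by move/le_trans; apply; rewrite ler_wpM2l ?frob_ge0 // le_bigmax.
Qed.

Let uWp p : unitary_map (ntensmx W p).
Proof. exact: unitary_map_ntensmx. Qed.

Definition test_op p g : 'M[Cplx R]_(d ^ p) :=
  pinch (ntensmx W p) (fun k => digit_sum h k) (ntensmx (adact (U g) rho) p).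

Lemma sigma_gram g : sigma g = (B *m (U g) ^t*) ^t* *m (B *m (U g) ^t*).
Proof. by rewrite rhoE gram_adact. Qed.

Lemma test_op_self p g :
  c ^+ p <= (p.+1 ^ d)%:R * orbit_value (test_op p g) g.
Proof.
have [kappa kappaP] := digit_sum_type h p.
have := pinch_ge (uWp p) (B := ntensmx (B *m (U g) ^t*) p)
  (X := ntensmx (sigma g) p) kappaP.
rewrite frob_ntensmx (frob_adact _ (uU g)) card_ffun !card_ord.
by apply; rewrite sigma_gram gram_ntensmx.
Qed.

Lemma test_op_other p g k r : 0 <= r ->
  (forall t, ov (adact (E t) rho) (sigma (g^-1 * k)%g) <= c * r) ->
  orbit_value (test_op p g) k <= (c * r) ^+ p.
Proof.
move=> r_ge0 gap.
have [t le_t] := pinch_le (fun l => digit_sum h l) (uWp p)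
  (ntensmx (sigma g) p) (ntensmx (sigma k) p).
apply: le_trans le_t _.
rewrite propagator_ntensmx // adact_ntensmx -ntensmx_mul mxtrace_ntensmx.
(* Conjugating by U_g and moving the evolution across the trace reduces the pair (g, k) to [rho] and
   g^-1 k, with time reversed. *)
have trE : \tr (sigma g *m adact (E t) (sigma k))
    = \tr (adact (E (- t)) rho *m sigma (g^-1 * k)%g).
  rewrite -{1}[k](mulKVg g) -(adact_repM U_rep) -evol.
  rewrite (adactM _ _ (uU g)) (mxtrace_adact _ (uU g)) -[LHS](mxtrace_adact _ (uE (- t))).
  rewrite -(adactM _ _ (uE (- t))) (adact_propagatorD h W_unitary) addNr.
  by rewrite (propagator0 h W_unitary) adact1.
have gramE : adact (E (- t)) rho = (B *m (E (- t)) ^t*) ^t* *m (B *m (E (- t)) ^t*).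
  by rewrite rhoE gram_adact.
have := gap (- t); rewrite trE /ov gramE sigma_gram mxtrace_gram.
by rewrite -rmorphXn /= => le_cr; rewrite lerXn2r ?nnegrE ?frob_ge0 // mulr_ge0 // frob_ge0.
Qed.

Lemma test_op_adj p g : (test_op p g) ^t* = test_op p g.
Proof. by rewrite /test_op pinch_adj -ntensmx_adj adact_adj rho_adj. Qed.

Lemma test_op_comm p g : test_op p g *m ham_copies H p = ham_copies H p *m test_op p g.
Proof. by rewrite ham_copies_fcalc // pinch_comm. Qed.

(* A commutes with the time evolution of p copies, so the p-th power of U_(gk) rho
   may be compared with that of an evolution of U_g rho, which is close to it. *)
Lemma orbit_value_coset p (A : 'M[Cplx R]_(d ^ p)) (g k : gT) :
  A ^t* = A -> A *m ham_copies H p = ham_copies H p *m A -> k \in K ->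
  orbit_value A (g * k)%g = orbit_value A g.
Proof.
move=> A_adj A_comm /(stabP _ _ _ W_unitary) kK; have c_gt0 := purity_gt0.
apply/eqP; rewrite -subr_eq0; set theta := _ - _; apply: contraT => theta_neq0.
have theta2_gt0 : 0 < theta ^+ 2 by rewrite exprn_even_gt0.
(* [L] is the slope in Bernoulli's bound for p-th powers. The contradiction will be M delta <=
   theta^2 <= (M - 1) delta, the first by the choice of delta, the second by Cauchy-Schwarz. *)
pose L := p%:R * c ^+ p.-1.
have L_ge0 : 0 <= L by rewrite mulr_ge0 // exprn_ge0 // ltW.
pose M := 2 * (frob A * L) + 1.
have AL_ge0 : 0 <= frob A * L by rewrite mulr_ge0 ?frob_ge0.
have M_gt0 : 0 < M by rewrite ltr_wpDl // mulr_ge0.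
(* The cap c keeps the base c - delta of the p-th power nonnegative. *)
pose delta := Num.min c (theta ^+ 2 / M).
have delta_gt0 : 0 < delta by rewrite lt_min c_gt0 divr_gt0.
have delta2_gt0 : 0 < 2 * delta by rewrite mulr_gt0.
have [t near_t] := kK _ delta2_gt0.
pose X := adact (U g) (adact (E t) rho); pose Y := adact (U g) (sigma k).
have X_adj : X ^t* = X by rewrite /X !adact_adj rho_adj.
have Xc : frob X = c by rewrite /X (frob_adact _ (uU g)) (frob_adact _ (uE t)).
have Yc : frob Y = c by rewrite /Y (frob_adact _ (uU g)) (frob_adact _ (uU k)).
have YE : Y = sigma (g * k)%g by rewrite /Y adact_repM.
have valX : complex.Re (\tr (A *m ntensmx X p)) = orbit_value A g.
  have EA : ntensmx (E t) p *m A = A *m ntensmx (E t) p.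
    rewrite -propagator_ntensmx //; apply: propagator_comm; first exact: uWp.
    by rewrite -ham_copies_fcalc // A_comm.
  have -> : ntensmx X p = adact (ntensmx (E t) p) (ntensmx (sigma g) p).
    by rewrite adact_ntensmx /X evol.
  have uEp := unitary_map_ntensmx p (uE t).
  have {1}-> : A = adact (ntensmx (E t) p) A.
    have [EE _] := (unitary_mapP _).1 uEp.
    by rewrite adact_unlock EA -mulmxA EE mulmx1.
  by rewrite adactM // mxtrace_adact.
have near_XY : frob (X - Y) < 2 * delta.
  by rewrite /X /Y -adactN -adactD (frob_adact _ (uU g)).
have XpYp : frob (ntensmx Y p - ntensmx X p) <= 2 * (L * delta).
  rewrite frobB !frob_ntensmx Xc Yc frobip_sym frobip_unlock -ntensmx_adj X_adj -ntensmx_mul.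
  rewrite mxtrace_ntensmx.
  have XE : X = (B *m (U g *m E t) ^t*) ^t* *m (B *m (U g *m E t) ^t*).
    by rewrite /X adact_mul rhoE gram_adact.
  have ovE : \tr (X *m Y) = (ov X Y)%:C.
    by rewrite /ov YE XE sigma_gram mxtrace_gram.
  rewrite ovE -rmorphXn /=.
  have ov_ge : c - delta <= ov X Y.
    move: near_XY; rewrite (ov_frob_sub X_adj Xc Yc) ltr_pM2l // ltrBlDr => /ltW.
    by rewrite addrC -lerBlDr.
  have delta_le : delta <= c by rewrite ge_min lexx.
  have ovp : c ^+ p - L * delta <= ov X Y ^+ p.
    apply: le_trans (bernoulli_exprB p (ltW delta_gt0) delta_le) _.
    rewrite lerXn2r // nnegrE ?subr_ge0 //.
    by apply: le_trans ov_ge; rewrite subr_ge0.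
  by move: ovp; move: (ov X Y ^+ p) (c ^+ p) (L * delta) => x y z; lra.
have thetaE : theta = frobip A (ntensmx Y p - ntensmx X p).
  rewrite frobipDr frobipNr !frobip_unlock A_adj valX YE.
  by [].
have := frobip_CauchySchwarz A (ntensmx Y p - ntensmx X p); rewrite -thetaE => CS.
have : theta ^+ 2 <= frob A * (2 * (L * delta)).
  by apply: le_trans CS _; rewrite ler_wpM2l ?frob_ge0.
have : M * delta <= theta ^+ 2.
  by rewrite mulrC -ler_pdivlMr // ge_min lexx orbT.
have -> : M * delta = frob A * (2 * (L * delta)) + delta by rewrite /M; ring.
move=> le1 le2; have := le_trans le1 le2.
by rewrite gerDl leNgt delta_gt0.
Qed.

(* All pairs are separated at once by a combination of the test operators with
   coefficients s^i, s being a non-root of finitely many nonzero polynomials. *)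
Lemma separating_observable : exists p (A : 'M[Cplx R]_(d ^ p)),
  [/\ (0 < p)%N, A ^t* = A, A *m ham_copies H p = ham_copies H p *m A,
      forall g k : gT, k \in K -> orbit_value A (g * k)%g = orbit_value A g
    & forall g k : gT, (g^-1 * k)%g \notin K -> orbit_value A g != orbit_value A k].
Proof.
have c_gt0 := purity_gt0.
have [r /andP[r_ge0 r_lt1] gap] := uniform_gap.
have [p p_gt0 rp] := geometric_beats_polynomial d r_ge0 r_lt1.
have test_gt g k : (g^-1 * k)%g \notin K ->
    orbit_value (test_op p g) k < orbit_value (test_op p g) g.
  move=> gkK; have pd_gt0 : 0 < (p.+1 ^ d)%:R :> R by rewrite ltr0n expn_gt0.
  rewrite -(ltr_pM2l pd_gt0); apply: lt_le_trans (test_op_self p g).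
  apply: le_lt_trans (_ : (p.+1 ^ d)%:R * (c * r) ^+ p < _).
    by rewrite ler_wpM2l ?(ltW pd_gt0) //; apply: test_op_other => // t; exact: gap.
  by rewrite exprMn mulrCA [_ * r ^+ p]mulrC gtr_pMr // exprn_gt0.
pose A_ (i : 'I_#|gT|) : 'M[Cplx R]_(d ^ p) := test_op p (enum_val i).
(* Its value at s is the difference, between g and k, of the combination with coefficients s^i. For
   distinct cosets it is nonzero, since the coefficient belonging to the test operator of g is
   positive. *)
pose Q (g k : gT) : {poly R} := \poly_(i < #|gT|) (if insub i is Some j then
  orbit_value (A_ j) g - orbit_value (A_ j) k else 0).
have Q_neq0 g k : (g^-1 * k)%g \notin K -> Q g k != 0.
  move=> gkK; apply/eqP => /polyP/(_ (enum_rank g)).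
  rewrite coef_poly ltn_ord coef0 valK /A_ enum_rankK => /eqP.
  by rewrite subr_eq0 => /eqP eq_val; have := test_gt _ _ gkK; rewrite eq_val ltxx.
have [s Qs] : exists s, (\prod_(x : gT * gT | (x.1^-1 * x.2)%g \notin K) Q x.1 x.2).[s] != 0.
  by apply: poly_nonroot; apply/prodf_neq0 => x; exact: Q_neq0.
pose A := \sum_(i < #|gT|) (s ^+ i)%:C *: A_ i.
have valA g : orbit_value A g = \sum_(i < #|gT|) s ^+ i * orbit_value (A_ i) g.
  rewrite /orbit_value mulmx_suml; under [RHS]eq_bigr do rewrite -complex_ReZ -mxtraceZ scalemxAl.
  apply: (big_morph (fun Z => complex.Re (\tr Z))) => [X Y|].
    by rewrite mxtraceD complex_ReD.
  by rewrite linear0.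
exists p, A.
have A_adj : A ^t* = A.
  rewrite adjmx_sum; apply: eq_bigr => i _.
  by rewrite adjmxZ test_op_adj conj_Creal // complex_real.
have A_comm : A *m ham_copies H p = ham_copies H p *m A.
  rewrite mulmx_suml mulmx_sumr; apply: eq_bigr => i _.
  by rewrite -scalemxAl -scalemxAr test_op_comm.
split=> [||||g k gkK]; try done; first by move=> g k; exact: (orbit_value_coset g A_adj A_comm).
move: Qs; rewrite horner_prod => /prodf_neq0/(_ (g, k) gkK) /=.
have -> : (Q g k).[s] = orbit_value A g - orbit_value A k.
  rewrite horner_poly !valA -sumrB; apply: eq_bigr => i _.
  by rewrite (valK i) -mulrBr mulrC.
by rewrite subr_eq0.
Qed.

End Separation.

(** * Concentration of the measured mean *)

Section Chernoff.
Variable R : realType.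

(** From exp(- x) >= 1 - x one gets exp(x) <= 1 / (1 - x), which lies below the quadratic for x <=
    1/2. *)
Lemma expR_le_quadratic (x : R) : x <= 2^-1 -> expR x <= 1 + x + 2 * x ^+ 2.
Proof.
move=> x_le; have x1_gt0 : 0 < 1 - x by lra.
rewrite -[x in expR x]opprK expRN -div1r ler_pdivrMr ?expR_gt0 //.
have q_ge0 : 0 <= 1 + x + 2 * x ^+ 2.
  have -> : 1 + x + 2 * x ^+ 2 = 2 * (x + 4^-1) ^+ 2 + 7 / 8 by field.
  by have := sqr_ge0 (x + 4^-1); lra.
apply: (@le_trans _ _ ((1 + x + 2 * x ^+ 2) * (1 - x))).
  have -> : (1 + x + 2 * x ^+ 2) * (1 - x) = 1 + x ^+ 2 * (1 - 2 * x) by ring.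
  by rewrite lerDl mulr_ge0 ?sqr_ge0 //; lra.
by rewrite ler_wpM2l // (le_trans _ (expR_ge1Dx (- x))).
Qed.

Variables (D : nat) (q : 'I_D -> R).
Hypotheses (q_ge0 : forall i, 0 <= q i) (q_sum : \sum_i q i = 1).

(** The linear term of the exponent has mean - theta eps under [q], which dominates the quadratic
    term once theta is small. *)
Lemma exponential_moment (a : 'I_D -> R) (eps : R) : 0 < eps ->
  exists2 theta, 0 < theta & exists2 eta, 0 < eta &
    \sum_i q i * expR (theta * (a i - (\sum_j q j * a j + eps))) <= expR (- eta).
Proof.
move=> eps_gt0; set v := \sum_j q j * a j.
pose B := 1 + \sum_i `|a i - v|.
have B_ge1 : 1 <= B by rewrite lerDl sumr_ge0.
have B_gt0 : 0 < B by rewrite (lt_le_trans ltr01).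
have aB i : `|a i - v| <= B.
  rewrite /B (bigD1 i) //= addrCA lerDl addr_ge0 // sumr_ge0 //.
(* The first bound keeps theta times the deviation below 1/2; the second makes the quadratic term at
   most half of theta eps, and the other half is left as eta. *)
pose theta := Num.min (2 * B)^-1 (eps / (4 * B ^+ 2)).
have theta_gt0 : 0 < theta.
  by rewrite lt_min invr_gt0 divr_gt0 ?mulr_gt0 ?exprn_gt0.
have thetaB : theta * B <= 2^-1.
  rewrite -ler_pdivlMr // ge_min; apply/orP; left.
  by rewrite invfM.
have theta_eps : 2 * (theta * B) ^+ 2 <= theta * (eps / 2).
  have : theta * (4 * B ^+ 2) <= eps.
    by rewrite -ler_pdivlMr ?mulr_gt0 ?exprn_gt0 // ge_min lexx orbT.
  move=> le_eps.
  have -> : 2 * (theta * B) ^+ 2 = theta * (theta * (4 * B ^+ 2) / 2) by field.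
  by rewrite ler_pM2l // ler_pM2r ?invr_gt0.
exists theta => //; exists (theta * (eps / 2)); first by rewrite mulr_gt0 ?divr_gt0.
have term i : q i * expR (theta * (a i - (v + eps)))
    <= expR (- (theta * eps)) * (q i * (1 + 2 * (theta * B) ^+ 2) + theta * (q i * a i - q i * v)).
  have -> : theta * (a i - (v + eps)) = - (theta * eps) + theta * (a i - v) by ring.
  rewrite expRD mulrCA ler_wpM2l ?expR_ge0 //.
  have x_le : theta * (a i - v) <= 2^-1.
    apply: le_trans thetaB; rewrite ler_pM2l //; exact: le_trans (ler_norm _) (aB i).
  have sq_le : (theta * (a i - v)) ^+ 2 <= (theta * B) ^+ 2.
    rewrite -real_normK ?num_real // lerXn2r ?nnegrE ?mulr_ge0 ?(ltW theta_gt0) ?(ltW B_gt0) //.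
    by rewrite normrM (gtr0_norm theta_gt0) ler_pM2l.
  apply: le_trans (ler_wpM2l (q_ge0 i) (expR_le_quadratic x_le)) _.
  have -> : q i * (1 + 2 * (theta * B) ^+ 2) + theta * (q i * a i - q i * v)
    = q i * (1 + theta * (a i - v) + 2 * (theta * B) ^+ 2) by ring.
  by rewrite ler_wpM2l // lerD2l ler_pM2l.
apply: le_trans (ler_sum _ (fun i _ => term i)) _.
rewrite -mulr_sumr big_split /= -mulr_suml q_sum mul1r -mulr_sumr sumrB -mulr_suml q_sum mul1r.
rewrite -/v subrr mulr0 addr0.
apply: le_trans (ler_wpM2l (expR_ge0 _) (expR_ge1Dx _)) _.
rewrite -expRD ler_expR; move: theta_eps.
have -> : theta * eps = theta * (eps / 2) + theta * (eps / 2) by field.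
by move: (theta * (eps / 2)) (2 * _) => x y; lra.
Qed.

(** Markov's inequality: the indicator is at most the exponential of theta times the excess, and the
    mean of that exponential factors over the digits. *)
Lemma upper_tail (a : 'I_D -> R) (eps : R) : 0 < eps ->
  exists2 eta, 0 < eta & forall N,
    \sum_(k < D ^ N) digit_prod q k * (N%:R * (\sum_j q j * a j + eps) <= digit_sum a k)%R%:R
      <= expR (- (eta * N%:R)).
Proof.
move=> eps_gt0; have [theta theta_gt0 [eta eta_gt0 moment]] := exponential_moment a eps_gt0.
exists eta => // N; set v := \sum_j q j * a j.
pose e i := expR (theta * (a i - (v + eps))).
have e_ge0 i : 0 <= e i by exact: expR_ge0.
have eE (k : 'I_(D ^ N)) : expR (theta * (digit_sum a k - N%:R * (v + eps))) = digit_prod e k.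
  rewrite -expR_digit_sum digit_sumZ; congr (expR (theta * _)).
  have := digit_sumD a (fun=> - (v + eps)) k; rewrite digit_sum_const mulrN => <-.
  by [].
apply: (@le_trans _ _ (\sum_(k < D ^ N) digit_prod (fun i => q i * e i) k)).
  apply: ler_sum => k _; rewrite digit_prodM ler_wpM2l ?digit_prod_ge0 // -eE.
  case: (leP (N%:R * (v + eps)) (digit_sum a k)) => [le_k|_]; last exact: expR_ge0.
  have -> : true%:R = expR 0 :> R by rewrite expR0.
  by rewrite ler_expR mulr_ge0 ?(ltW theta_gt0) // subr_ge0.
rewrite sum_digit_prod -mulNr expRM_natr lerXn2r ?nnegrE ?expR_ge0 //.
by rewrite sumr_ge0 // => i _; rewrite mulr_ge0.
Qed.

Lemma chernoff_bound (a : 'I_D -> R) (eps : R) : 0 < eps ->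
  exists2 eta, 0 < eta & forall N,
    1 - 2 * expR (- (eta * N%:R))
      <= \sum_(k < D ^ N) digit_prod q k
           * (`|digit_sum a k - N%:R * (\sum_j q j * a j)| < N%:R * eps)%R%:R.
Proof.
move=> eps_gt0; have [eta1 eta1_gt0 up] := upper_tail a eps_gt0.
(* The lower tail is the upper tail of the negated values, written with the factor -1 to fit
   [digit_sumZ]. *)
have [eta2 eta2_gt0 low] := upper_tail (fun i => -1 * a i) eps_gt0.
exists (Num.min eta1 eta2) => [|N]; first by rewrite lt_min eta1_gt0.
have eta_le eta : Num.min eta1 eta2 <= eta ->
    expR (- (eta * N%:R)) <= expR (- (Num.min eta1 eta2 * N%:R)).
  by move=> le_eta; rewrite ler_expR lerN2 ler_wpM2r.
have := up N; move=> /le_trans/(_ (eta_le eta1 _)); rewrite ge_min lexx => /(_ isT) up'.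
have := low N; move=> /le_trans/(_ (eta_le eta2 _)); rewrite ge_min lexx orbT => /(_ isT) low'.
move: up' low'; set v := \sum_j q j * a j; set E := expR _.
have -> : \sum_j q j * (-1 * a j) = - v.
  by rewrite /v -sumrN; apply: eq_bigr => j _; ring.
move=> up' low'.
have total : \sum_(k < D ^ N) digit_prod q k = 1 by rewrite sum_digit_prod q_sum expr1n.
have EE : 2 * E = E + E by ring.
rewrite EE lerBlDr -[leLHS]total.
apply: le_trans (lerD (lexx _) (lerD up' low')).
rewrite -!big_split /=; apply: ler_sum => k _; rewrite -!mulrDr ler_peMr ?digit_prod_ge0 //.
rewrite digit_sumZ mulN1r; case: ltP => [_|].
  by rewrite lerDl addr_ge0.
rewrite add0r ler_normr => /orP[] far.
  have -> : N%:R * (v + eps) <= digit_sum a k by move: far; rewrite mulrDr lerBrDr addrC.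
  by rewrite lerDl.
have -> : N%:R * (- v + eps) <= - digit_sum a k.
  move: far; rewrite mulrDr mulrN.
  by move: (N%:R * eps) (N%:R * v) (digit_sum a k) => x y z; lra.
by rewrite lerDr.
Qed.

End Chernoff.

Section Measurement.
Variable R : realType.

(** Testing positivity on eigenvectors shows that the eigenvalues are nonnegative; [B] is the
    positive square root. *)
Lemma psd_gram d (rho : 'M[Cplx R]_d) : psdmx rho -> exists B : 'M[Cplx R]_d, rho = B ^t* *m B.
Proof.
move=> [/hermitian_fcalc[W [s [uW rhoE]]] rho_ge0].
have s_ge0 i : 0 <= s i.
  have := rho_ge0 (W ^t* *m delta_mx i 0).
  rewrite adjmxM trmxCK !mulmxA -(mulmxA _ W) -(mulmxA _ _ (W ^t*)) rhoE conj_fcalc //.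
  rewrite mul_mx_diag mxE (bigD1 i) //= big1 => [|j /negPf ji].
    by rewrite !mxE !eqxx addr0 rmorph1 mul1r mulr1 ler0c.
  by rewrite !mxE ji mulr0.
exists (fcalc W (fun i => (Num.sqrt (s i))%:C)).
rewrite fcalc_adj fcalcM // rhoE; apply: eq_fcalc => i.
by rewrite conj_Creal ?complex_real // -rmorphM -expr2 sqr_sqrtr.
Qed.

Lemma psd_projector n (P : 'M[Cplx R]_n) : P ^t* = P -> P *m P = P -> psdmx P.
Proof.
move=> P_adj PP; split=> [|v]; first exact/hermsymmxP.
have -> : v ^t* *m P *m v = (P *m v) ^t* *m (P *m v).
  by rewrite adjmxM P_adj !mulmxA -(mulmxA _ P P) PP.
by rewrite -trace_mx11 frobE ler0c frob_ge0.
Qed.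

Lemma orthogonal_projectors_sub_povm n (I : finType) (X0 : {set I}) (M : I -> 'M[Cplx R]_n) :
  (forall x, x \in X0 -> (M x) ^t* = M x) ->
  {in X0 &, forall x y, M x *m M y = if x == y then M x else 0} -> sub_povm X0 M.
Proof.
move=> M_adj M_orth; split=> [x x_X0|].
  by apply: psd_projector; [exact: M_adj | rewrite M_orth // eqxx].
set S := \sum_(x in X0) M x.
have S_adj : S ^t* = S by rewrite /S adjmx_sum; apply: eq_bigr => x /M_adj.
have SS : S *m S = S by exact: sum_orth_idem.
apply: psd_projector; first by rewrite adjmxD adjmx1 linearN map_mxN S_adj.
by rewrite mulmxBl mul1mx mulmxBr mulmx1 SS subrr subr0.
Qed.

Variables (D : nat) (W : 'M[Cplx R]_D) (a : 'I_D -> R) (eps : R).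
Hypothesis W_unitary : unitary_map W.
Local Notation A := (fcalc W (fun i => (a i)%:C)).

(* Spectral projector of the sum of N copies of A on the values whose distance
   to N v is less than N eps. *)
Definition mean_projector (N : nat) (v : R) : 'M[Cplx R]_(D ^ N) :=
  fcalc (ntensmx W N) (fun k => (`|digit_sum a k - N%:R * v| < N%:R * eps)%R%:R).

Let uWN N : unitary_map (ntensmx W N) := unitary_map_ntensmx N W_unitary.

Lemma mean_projector_adj N v : (mean_projector N v) ^t* = mean_projector N v.
Proof. by rewrite /mean_projector fcalc_adj; apply: eq_fcalc => k; rewrite rmorph_nat. Qed.

Lemma mean_projector_idem N v :
  mean_projector N v *m mean_projector N v = mean_projector N v.
Proof.
rewrite /mean_projector (fcalcM _ _ (uWN N)); apply: eq_fcalc => k.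
by rewrite -natrM mulnb andbb.
Qed.

(** By the triangle inequality no value lies in both windows. For N = 0 the strict inequality makes
    the windows empty, so this case is covered too. *)
Lemma mean_projector_orth N v w : 2 * eps <= `|v - w| ->
  mean_projector N v *m mean_projector N w = 0.
Proof.
move=> far; rewrite /mean_projector (fcalcM _ _ (uWN N)).
have -> : 0 = fcalc (ntensmx W N) (fun=> 0).
  by apply/matrixP=> i j; rewrite fcalcE mxE big1 // => k _; rewrite mul0r.
apply: eq_fcalc => k; rewrite -natrM mulnb.
case: ltP => //= near_v; case: ltP => //= near_w.
have : N%:R * `|v - w| < N%:R * (2 * eps).
  rewrite -{1}[N%:R]ger0_norm // -normrM.
  have -> : N%:R * (v - w) = (digit_sum a k - N%:R * w) - (digit_sum a k - N%:R * v) by ring.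
  apply: le_lt_trans (ler_normB _ _) _.
  have -> : N%:R * (2 * eps) = N%:R * eps + N%:R * eps by ring.
  exact: ltrD.
by rewrite ltNge ler_wpM2l.
Qed.

Lemma mean_projector_comm N v (G : 'M[Cplx R]_D) : A *m G = G *m A ->
  mean_projector N v *m ham_copies G N = ham_copies G N *m mean_projector N v.
Proof.
move=> AG; apply: (fcalc_comm (a := fun k => (digit_sum a k)%:C)) => // [i j [->] //|].
by rewrite -ham_copies_fcalc // ham_copies_comm.
Qed.

(** The diagonal of [tau] in the eigenbasis of A is a probability distribution with mean tr(A tau);
    N copies give its N-fold product, to which Chernoff's bound applies. *)
Lemma mean_projector_prob (tau : 'M[Cplx R]_D) (C : 'M[Cplx R]_D) :
  0 < eps -> tau = C ^t* *m C -> \tr tau = 1 ->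
  exists2 eta, 0 < eta & forall N,
    (1 - 2 * expR (- (eta * N%:R)))%:C
      <= \tr (ntensmx tau N *m mean_projector N (complex.Re (\tr (A *m tau)))).
Proof.
move=> eps_gt0 tauE tau_tr.
have WtauW : adact W tau = (C *m W ^t*) ^t* *m (C *m W ^t*) by rewrite tauE gram_adact.
pose q i := complex.Re (adact W tau i i).
have diag_ge0 i : 0 <= adact W tau i i.
  rewrite WtauW mxE sumr_ge0 // => j _.
  by rewrite adjmxE mulrC -normCK exprn_ge0.
have qE i : adact W tau i i = (q i)%:C by rewrite RRe_real // ger0_real.
have q_ge0 i : 0 <= q i by rewrite -ler0c -qE.
have q_sum : \sum_i q i = 1.
  apply: complexI; rewrite rmorph1 -tau_tr -(mxtrace_adact _ W_unitary) rmorph_sum.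
  by apply: eq_bigr => i _; rewrite qE.
have mean : \sum_i q i * a i = complex.Re (\tr (A *m tau)).
  rewrite mxtrace_fcalc -adact_unlock complex_Re_sum; apply: eq_bigr => i _.
  by rewrite complex_ReZ mulrC.
have [eta eta_gt0 tail] := chernoff_bound q_ge0 q_sum a eps_gt0.
exists eta => // N; have := tail N; rewrite mean -lecR => /le_trans; apply.
move: (complex.Re _) => v; rewrite [leRHS]mxtrace_mulC /mean_projector mxtrace_fcalc.
rewrite -adact_unlock adact_ntensmx rmorph_sum.
rewrite le_eqVlt; apply/orP; left; apply/eqP; apply: eq_bigr => k _.
rewrite ntensmx_diagE mulrC rmorphM rmorph_nat /=; congr (_ * _).
rewrite -digit_prod_real; congr (digit_prod _ k); apply: boolp.funext => i.
by rewrite qE.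
Qed.

End Measurement.

(** * The sub-POVMs *)

Section FinalAssembly.
Variable R : realType.

Lemma positive_gap (T : finType) (v : T -> R) :
  exists2 eps, 0 < eps & forall x y, v x != v y -> 2 * eps <= `|v x - v y|.
Proof.
(* The default 1 is the value of the minimum when [v] is constant. *)
pose gap := \big[Num.min/1]_(s : T * T | v s.1 != v s.2) `|v s.1 - v s.2|.
exists (gap / 2) => [|x y xy].
  rewrite divr_gt0 //; apply/bigmin_gtP; split=> // s.
  by rewrite -subr_eq0 normr_gt0.
rewrite mulrC divfK ?pnatr_eq0 // /gap.
exact: (bigmin_le_cond _ (fun s => `|v s.1 - v s.2|) (j := (x, y))).
Qed.

(** For k >= 2 and eta k >= 1 one has exp(eta k (k - 1)) >= 1 + eta k (k - 1) >= 2, which absorbs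
    the factor 2. *)
Lemma error_rate (eta : R) : 0 < eta -> exists k0 : nat, forall k, (k0 <= k)%N ->
  1 - expR (- (eta * k%:R)) <= 1 - 2 * expR (- (eta * (k ^ 2)%N%:R)).
Proof.
move=> eta_gt0; exists (Num.bound eta^-1).+2 => k le_k.
have k_ge2 : 2 <= k%:R :> R by rewrite ler_nat (leq_trans _ le_k).
have eta_k : 1 <= eta * k%:R.
  have /archi_boundP bound_gt : 0 <= eta^-1 by rewrite invr_ge0 ltW.
  rewrite -ler_pdivrMl // mulr1 (le_trans (ltW bound_gt)) // ler_nat.
  by apply: leq_trans le_k; rewrite -addn2 leq_addr.
rewrite lerD2l lerN2 natrX.
have -> : eta * k%:R ^+ 2 = eta * k%:R + eta * k%:R * (k%:R - 1) by ring.
rewrite opprD expRD mulrCA ger_pMr ?expR_gt0 // expRN ler_pdivrMr ?expR_gt0 // mul1r.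
apply: le_trans (expR_ge1Dx _); rewrite -lerBlDl.
apply: (@le_trans _ _ (eta * k%:R * 1)); first by lra.
by rewrite ler_wpM2l; lra.
Qed.

End FinalAssembly.

Theorem lemma13 (R : realType) (gT : finGroupType) (d : nat)
    (U : gT -> 'M[Cplx R]_d) (H rho : 'M[Cplx R]_d) (beta : R)
    (U_rep : proj_unitary_rep U)
    (H_ham : hamiltonian H)
    (U_H_comm : forall g, U g *m H = H *m U g)
    (rho_state : state rho)
    (beta_gt0 : 0 < beta) :
  let K := time_orbit_stab U H rho in
  group_set K /\
  exists (m : nat) (alpha : R)
         (Rt : forall k : nat, {set gT} -> 'M[Cplx R]_(d ^ (m * k ^ 2))),
    [/\ (0 < m)%N,
        0 < alpha,
        forall k, sub_povm (lcosets K [set: gT]) (Rt k),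
        forall k, control_admissible beta (ham_copies H (m * k ^ 2))
                    (lcosets K [set: gT]) (Rt k)
      & exists k0 : nat, forall k : nat, (k0 <= k)%N -> forall g : gT,
          (1 - expR (- (alpha * k%:R)))%:C
            <= \tr (ntensmx (U g *m rho *m (U g) ^t*) (m * k ^ 2)
                      *m Rt k (g *: K)%g)].
Proof.
have [rho_psd rho_tr] := rho_state.
have [B rhoE] := psd_gram rho_psd.
have [W [h [W_unitary HE]]] := hermitian_fcalc H_ham.2.
subst H; move=> K.
have K_group : group_set K by exact: time_orbit_stab_group.
split=> //; pose KG := Group K_group.
have [p [A [p_gt0 A_adj A_comm A_coset A_sep]]] :=
  separating_observable U_rep W_unitary U_H_comm rhoE rho_tr.
have [WA [a [WA_unitary AE]]] := hermitian_fcalc ((hermsymmxP A).2 A_adj).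
subst A; set A := fcalc WA _ in A_adj A_comm A_coset A_sep.
pose v := orbit_value U rho A.
have [eps eps_gt0 gap] := positive_gap v.
(* [repr] picks an arbitrary element of the coset; centring the window at its value is legitimate
   because [v] is constant on cosets. *)
have repr_lcoset g : v (repr (g *: K)%g) = v g.
  have /lcosetP[k kK ->] : repr (g *: K)%g \in (g *: K)%g.
    by apply: (mem_repr g); exact: (lcoset_refl KG).
  exact: A_coset.
have tau_tr g : \tr (ntensmx (adact (U g) rho) p) = 1.
  rewrite mxtrace_ntensmx (mxtrace_adact _ (rep_unitary U_rep g)) rho_tr.
  by rewrite expr1n.
have /boolp.choice[eta etaP] : forall g, exists eta, 0 < eta /\ forall N,
    (1 - 2 * expR (- (eta * N%:R)))%:C
      <= \tr (ntensmx (ntensmx (adact (U g) rho) p) N *m mean_projector WA a eps N (v g)).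
  move=> g; have tauE : ntensmx (adact (U g) rho) p
      = (ntensmx (B *m (U g) ^t*) p) ^t* *m ntensmx (B *m (U g) ^t*) p.
    by rewrite rhoE gram_adact gram_ntensmx.
  have [eta eta_gt0 etaP] := mean_projector_prob a WA_unitary eps_gt0 tauE (tau_tr g).
  by exists eta; split=> // N; exact: etaP.
(* The rate may depend on the state and not only on its coset, so the minimum runs over the whole
   group. *)
pose alpha := \big[Num.min/1]_g eta g.
have alpha_gt0 : 0 < alpha by apply/bigmin_gtP; split=> // g _; have [] := etaP g.
pose r N := sval (cid (regroup_copies R d p N)).
have rP N : [/\ bijective (r N),
    forall X : 'M[Cplx R]_d, ntensmx X (p * N) = mxsub (r N) (r N) (ntensmx (ntensmx X p) N)
  & forall G : 'M[Cplx R]_d,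
      ham_copies G (p * N) = mxsub (r N) (r N) (ham_copies (ham_copies G p) N)].
  exact: svalP (cid (regroup_copies R d p N)).
pose M N (x : {set gT}) := mean_projector WA a eps N (v (repr x)).
pose Rt k x := mxsub (r (k ^ 2)%N) (r (k ^ 2)%N) (M (k ^ 2)%N x).
have Rt_adj k x : (Rt k x) ^t* = Rt k x.
  by rewrite /Rt adjmx_sub /M mean_projector_adj.
have Rt_orth k : {in lcosets K [set: gT] &, forall x y,
    Rt k x *m Rt k y = if x == y then Rt k x else 0}.
  have [bij_r _ _] := rP (k ^ 2)%N.
  move=> x y /imsetP[g _ ->] /imsetP[g' _ ->].
  rewrite !lcosetE /Rt -mxsubM //; case: eqP => [->|neq_gg'].
    by rewrite /M mean_projector_idem.
  rewrite /M mean_projector_orth //; first by apply/matrixP=> i j; rewrite !mxE.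
  (* Distinct cosets have distinct expectations, which are then at least 2 eps apart. *)
  rewrite !repr_lcoset; apply: gap; apply: A_sep.
  apply: contra_notN neq_gg'; rewrite -mem_lcoset => g'g.
  exact/esym/(lcoset_eqP (G := KG)).
exists p, alpha, Rt; split=> // [k|k|].
- by apply: orthogonal_projectors_sub_povm.
- apply: projective_control_admissible => //; first exact: hamiltonian_copies.
  have [bij_r _ rH] := rP (k ^ 2)%N.
  move=> x _; rewrite rH /Rt -!mxsubM //; congr (mxsub _ _ _).
  exact: mean_projector_comm.
have [k0 k0P] := error_rate alpha_gt0; exists k0 => k /k0P rate g.
have [bij_r rU _] := rP (k ^ 2)%N.
rewrite -adact_unlock rU /Rt -mxsubM // mxtrace_mxsub // /M repr_lcoset.
have [_ /(_ (k ^ 2)%N)] := etaP g; apply: le_trans; rewrite lecR.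
apply: le_trans rate _; rewrite lerD2l lerN2 ler_pM2l // ler_expR lerN2.
by rewrite ler_wpM2r // bigmin_le.
Qed.
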